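(* The set $\mathcal{S}=\{q^{-\frac12ab}X_m^aX_{m+1}^b\mid m\in\mathbb{Z},(a,b)\in\mathbb{Z}_{\ge0}^2\}\cup\{S_n(X_\delta)\mid n\ge1\}$ is the triangular basis of $\mathcal{A}_q(1,4)$, i.e. $\mathcal{S}=\{C_{(a,b)}\mid (a,b)\in\mathbb{Z}^2\}$.
   Context: Let $q^{1/2}$ be a formal variable and let $\mathcal{T}$ be the quantum torus over $\mathbb{Z}[q^{\pm\frac12}]$ generated by $X_1^{\pm1},X_2^{\pm1}$ with $X_1X_2=qX_2X_1$, with skew field of fractions $\mathcal{F}$. Define $X_k\in\mathcal{F}$ ($k\in\mathbb{Z}$) by $X_{k-1}X_{k+1}=q^{\frac12}X_k+1$ for $k$ odd and $X_{k-1}X_{k+1}=q^2X_k^4+1$ for $k$ even; $\mathcal{A}_q(1,4)$ is the $\mathbb{Z}[q^{\pm\frac12}]$-subalgebra of $\mathcal{F}$ generated by all $X_k$ (it lies in $\mathcal{T}$). Put $X^{(a,b)}=q^{-\frac12ab}X_1^aX_2^b$. The bar-involution is the $\mathbb{Z}$-linear map on $\mathcal{T}$ with $\overline{q^{r/2}X^{(a,b)}}=q^{-r/2}X^{(a,b)}$. Let $X_\delta=X^{(-1,-2)}+X^{(-1,2)}+X^{(1,-2)}+(q^{-\frac12}+q^{\frac12})X^{(0,-2)}$, and let $S_n$ be the Chebyshev polynomials $S_0=1$, $S_1=x$, $S_2=x^2-1$, $S_{n+1}=S_nx-S_{n-1}$ ($n\ge2$). For $x\in\mathbb{Z}$, $[x]_+=\max(x,0)$.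 The standard monomials are $E_{(a,b)}=q^{-\frac12ab}X_3^{[-a]_+}X_1^{[a]_+}X_2^{[b]_+}X_0^{[-b]_+}$ for $(a,b)\in\mathbb{Z}^2$; they form a $\mathbb{Z}[q^{\pm\frac12}]$-basis of $\mathcal{A}_q(1,4)$. Let $\mathcal{A}_+=\bigoplus_{(a,b)}\mathbb{Z}[q^{-\frac12}]E_{(a,b)}$. For each $(a,b)\in\mathbb{Z}^2$ there is a unique element $C_{(a,b)}\in\mathcal{A}_q(1,4)$ with $\overline{C_{(a,b)}}=C_{(a,b)}$ and $C_{(a,b)}-E_{(a,b)}\in q^{-\frac12}\mathcal{A}_+$ (Berenstein–Zelevinsky); the set $\{C_{(a,b)}\}$ is the (canonical) triangular basis. *)

(* Defs.v *)
(* Concrete model of the quantum torus T over Z[q^{+-1/2}]: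
   writing v := q^{1/2}, an element of T is a finitely supported function
   Z^3 -> Z, where the key (r, a, b) stands for the monomial v^r * X^(a,b),
   X^(a,b) = q^{-ab/2} X_1^a X_2^b.  Multiplication is the twisted one:
   v^r1 X^(a1,b1) * v^r2 X^(a2,b2) = v^(r1+r2+a1*b2-b1*a2) X^(a1+a2,b1+b2). *)
From HB Require Import structures.
From mathcomp Require Import all_boot all_order all_algebra.
From mathcomp Require Import finmap.
Set Implicit Arguments. Unset Strict Implicit. Unset Printing Implicit Defensive.
Import Order.TTheory GRing.Theory Num.Theory.
Local Open Scope fset_scope.
Local Open Scope ring_scope.

Definition key := (int * int * int)%type.

Definition qtorus := {fsfun key -> int with 0}.

Definition qzero : qtorus := [fsfun k in fset0 => (0 : int)].
Definition qadd (f g : qtorus) : qtorus :=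
  [fsfun k in finsupp f `|` finsupp g => f k + g k].
Definition qopp (f : qtorus) : qtorus := [fsfun k in finsupp f => - f k].
Definition qsub (f g : qtorus) : qtorus := qadd f (qopp g).

Definition qmono (c : int) (k : key) : qtorus :=
  [fsfun x in [fset k] => if x == k then c else 0].

Definition kmul (k1 k2 : key) : key :=
  let: (r1, a1, b1) := k1 in let: (r2, a2, b2) := k2 in
  (r1 + r2 + (a1 * b2 - b1 * a2), a1 + a2, b1 + b2).

Definition qmul (f g : qtorus) : qtorus :=
  \big[qadd/qzero]_(k1 <- finsupp f) \big[qadd/qzero]_(k2 <- finsupp g)
     qmono (f k1 * g k2) (kmul k1 k2).

Definition qone : qtorus := qmono 1 (0, 0, 0).
Definition qpow (f : qtorus) (n : nat) : qtorus := iter n (qmul f) qone.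

Definition vq (r : int) : qtorus := qmono 1 (r, 0, 0).
Definition tX (a b : int) : qtorus := qmono 1 (0, a, b).

Definition qbar (f : qtorus) : qtorus :=
  \big[qadd/qzero]_(k <- finsupp f) qmono (f k) (- k.1.1, k.1.2, k.2).

Definition Xdelta : qtorus :=
  qadd (tX (-1) (-2)) (qadd (tX (-1) 2) (qadd (tX 1 (-2))
    (qmul (qadd (vq (-1)) (vq 1)) (tX 0 (-2))))).

Fixpoint cheb (x : qtorus) (n : nat) : qtorus :=
  match n with
  | 0 => qone
  | 1 => x
  | (m.+1 as n').+1 => qsub (qmul (cheb x n') x) (cheb x m)
  end.

Definition oddz (k : int) : bool := odd `|k|%N.
Definition posp (x : int) : nat := if x is Posz n then n else 0.

Definition cluster_seq (X : int -> qtorus) : Prop :=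
  [/\ X 1 = tX 1 0, X 2 = tX 0 1 &
      forall k : int,
        qmul (X (k - 1)) (X (k + 1)) =
        if oddz k then qadd (qmul (vq 1) (X k)) qone
        else qadd (qmul (vq 4) (qpow (X k) 4)) qone].

Inductive inA (X : int -> qtorus) : qtorus -> Prop :=
  | inA_gen k : inA X (X k)
  | inA_scal r : inA X (vq r)
  | inA_add f g : inA X f -> inA X g -> inA X (qadd f g)
  | inA_opp f : inA X f -> inA X (qopp f)
  | inA_mul f g : inA X f -> inA X g -> inA X (qmul f g).

Definition stdE (X : int -> qtorus) (a b : int) : qtorus :=
  qmul (vq (- (a * b)))
    (qmul (qpow (X 3) (posp (- a)))
      (qmul (qpow (X 1) (posp a))
        (qmul (qpow (X 2) (posp b)) (qpow (X 0) (posp (- b)))))).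

(* A_+ = sum of Z[q^{-1/2}] E_(a,b): finite sums of n * v^{-j} * E_(a,b) *)
Definition inAplus (X : int -> qtorus) (f : qtorus) : Prop :=
  exists s : seq (int * nat * (int * int)),
    f = \big[qadd/qzero]_(t <- s)
          qmul (qmono t.1.1 (- (t.1.2 : int), 0, 0)) (stdE X t.2.1 t.2.2).

Definition is_tri_basis_elt (X : int -> qtorus) (a b : int) (c : qtorus) : Prop :=
  [/\ inA X c, qbar c = c &
      exists g, inAplus X g /\ qsub c (stdE X a b) = qmul (vq (-1)) g].

Definition inS (X : int -> qtorus) (s : qtorus) : Prop :=
  (exists (m : int) (a b : nat),
      s = qmul (vq (- (a%:Z * b%:Z))) (qmul (qpow (X m) a) (qpow (X (m + 1)) b)))
  \/ (exists n : nat, (1 <= n)%N /\ s = cheb Xdelta n).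

(* Main.v *)
(** Write [v = q^(1/2)] and let [E^m_(a,b)] be the standard monomials of the seed
    [(X_m, X_(m+1))].  A direct computation expresses [X_(m+3)] in the frame
    [X_(m-1), ..., X_(m+2)] with correction terms in [v^-1 Z[v^-1]], so that
    [E^(m+1)_(a,b)] equals [E^m_(-b - p [-a]_+, a)] modulo [v^-1] times the lattice of
    [E^m]; the converse ring gives the opposite shift.  All seeds thus define the same
    lattice, each cluster monomial is congruent to a single [E_(a,b)], and iterating the
    shift reaches every index except [(-n, -2n)], [n >= 1].

    For these, [v^-n X_(2n+2) X_0] satisfies the Chebyshev recursion for left
    multiplication by [X_delta], so it differs from [S_n(X_delta)] by [v^-1] times
    elements of the lattice; and it is congruent to [E_(-n,-2n)], because [X_(2n+2)] has
    [X_1]-degree at least [-n].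

    Each [E_(a,b)] has lexicographically lowest term [X^(a,b)].  Hence the [E_(a,b)] are
    linearly independent, and a bar-invariant element of [v^-1 A_+] has a palindromic
    lowest coefficient in [v^-1 Z[v^-1]], so it vanishes. *)
Require Import Defs.
From HB Require Import structures.
From mathcomp Require Import all_boot all_order all_algebra.
From mathcomp Require Import finmap.
From mathcomp Require Import zify ring.
Set Implicit Arguments. Unset Strict Implicit. Unset Printing Implicit Defensive.
Import Order.TTheory GRing.Theory Num.Theory.
Local Open Scope ring_scope.
(** * Identities in abelian groups *)

Inductive aexp := AVar of nat | AAdd of aexp & aexp | AOpp of aexp | AZero.

Fixpoint aeval (V : zmodType) (e : seq V) (t : aexp) : V :=
  match t with
  | AVar n => nth 0 e n
  | AAdd t1 t2 => aeval e t1 + aeval e t2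
  | AOpp t1 => - aeval e t1
  | AZero => 0
  end.

Fixpoint acoef (t : aexp) (i : nat) : int :=
  match t with
  | AVar n => if i == n then 1 else 0
  | AAdd t1 t2 => acoef t1 i + acoef t2 i
  | AOpp t1 => - acoef t1 i
  | AZero => 0
  end.

(** A variable beyond the environment takes the default value 0 of [nth], so stopping the sum at
    [size e] loses nothing. *)
Lemma aevalE (V : zmodType) (e : seq V) t :
  aeval e t = \sum_(0 <= i < size e) nth 0 e i *~ acoef t i.
Proof.
elim: t => [n|t1 IH1 t2 IH2|t IH|] /=.
- have [lt_n|ge_n] := ltnP n (size e).
    rewrite (bigD1_seq n) ?iota_uniq ?mem_index_iota //= eqxx big1 ?addr0 // => i.
    by move/negPf->.
  rewrite nth_default // big_nat_cond big1 // => i; rewrite andbT => /andP[_ lt_i].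
  by case: eqP => // eq_in; rewrite eq_in ltnNge ge_n in lt_i.
- by rewrite IH1 IH2 -big_split; apply: eq_bigr => i _; rewrite mulrzDr.
- by rewrite IH -sumrN; apply: eq_bigr => i _; rewrite mulrNz.
- by rewrite big1.
Qed.

(** Both terms are integer combinations of the atoms, so finitely many integer comparisons suffice;
    [abel] discharges them by computation. *)
Lemma aevalP (V : zmodType) (e : seq V) t1 t2 :
  all (fun i => acoef t1 i == acoef t2 i) (iota 0 (size e)) -> aeval e t1 = aeval e t2.
Proof.
move=> /allP eq12; rewrite !aevalE; apply: eq_big_nat => i /andP[_ lt_i].
by have /eqP -> : acoef t1 i == acoef t2 i by apply: eq12; rewrite mem_iota.
Qed.

Ltac abel_add x e :=
  lazymatch e with
  | nil => constr:([:: x])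
  | ?y :: ?e' => match goal with
      | _ => let _ := match goal with _ => unify x y end in e
      | _ => let e'' := abel_add x e' in constr:(y :: e'')
      end
  end.
Ltac abel_env t e :=
  lazymatch t with
  | ?a + ?b => let e' := abel_env a e in abel_env b e'
  | - ?a => abel_env a e
  | 0 => e
  | ?x => abel_add x e
  end.
Ltac abel_idx x e :=
  match e with
  | ?y :: ?e' => let _ := match goal with _ => unify x y end in constr:(0%N)
  | ?y :: ?e' => let n := abel_idx x e' in constr:(S n)
  end.
Ltac abel_term t e :=
  lazymatch t with
  | ?a + ?b => let u := abel_term a e in let w := abel_term b e in constr:(AAdd u w)
  | - ?a => let u := abel_term a e in constr:(AOpp u)
  | 0 => constr:(AZero)
  | ?x => let n := abel_idx x e in constr:(AVar n)
  end.
(* Decides identities of abelian groups, with atoms compared up to conversion. *)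
Ltac abel :=
  match goal with |- @eq ?T ?s ?t =>
    let e0 := constr:(@nil T) in
    let e1 := abel_env s e0 in let e := abel_env t e1 in
    let u := abel_term s e in let w := abel_term t e in
    exact: (@aevalP _ e u w erefl)
  end.

(** * Lattices over [Z[v^-1]] *)

(* [sc r f] stands for [v^r f], where [v = q^(1/2)]. *)
Record scaling (R : pzRingType) (sc : int -> R -> R) : Prop := Scaling {
  scD : forall r f g, sc r (f + g) = sc r f + sc r g;
  sc_0 : forall f, sc 0 f = f;
  scA : forall r s f, sc r (sc s f) = sc (r + s) f;
  scMl : forall r f g, sc r f * g = sc r (f * g);
  scMr : forall r f g, f * sc r g = sc r (f * g) }.

Section Span.
Variables (R : pzRingType) (sc : int -> R -> R) (scP : scaling sc).

Lemma sc0r r : sc r 0 = 0.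
Proof. by apply: (addrI (sc r 0)); rewrite -(scD scP) !addr0. Qed.

Lemma scN r f : sc r (- f) = - sc r f.
Proof. by apply: (addrI (sc r f)); rewrite -(scD scP) !subrr sc0r. Qed.

Lemma scB r f g : sc r (f - g) = sc r f - sc r g.
Proof. by rewrite (scD scP) scN. Qed.

Lemma qcomm_expl t x y n : x * y = sc t (y * x) -> x ^+ n * y = sc (t * n%:Z) (y * x ^+ n).
Proof.
move=> xy; elim: n => [|n IH]; first by rewrite expr0 mul1r mulr1 mulr0 (sc_0 scP).
rewrite exprS -mulrA IH (scMr scP) mulrA xy (scMl scP) (scA scP) -mulrA -exprS.
by congr sc; lia.
Qed.

Lemma qcomm_expr t x y n : x * y = sc t (y * x) -> x * y ^+ n = sc (t * n%:Z) (y ^+ n * x).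
Proof.
move=> xy; elim: n => [|n IH]; first by rewrite expr0 mul1r mulr1 mulr0 (sc_0 scP).
rewrite exprS mulrA xy (scMl scP) -mulrA IH (scMr scP) (scA scP) mulrA -exprS.
by congr sc; lia.
Qed.

Lemma qcomm_exp t x y m n : x * y = sc t (y * x) ->
  x ^+ m * y ^+ n = sc (t * m%:Z * n%:Z) (y ^+ n * x ^+ m).
Proof. by move/(qcomm_expl m)/(qcomm_expr n). Qed.

Lemma qcomm_sym t x y : x * y = sc t (y * x) -> y * x = sc (- t) (x * y).
Proof. by move->; rewrite (scA scP) addrC subrr (sc_0 scP). Qed.

(* The [Z[v^-1]]-span of [G]. *)
Inductive Zspan (G : R -> Prop) : R -> Prop :=
  | Zspan0 : Zspan G 0
  | Zspan_gen (j : nat) x : G x -> Zspan G (sc (- (j : int)) x)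
  | ZspanD x y : Zspan G x -> Zspan G y -> Zspan G (x + y)
  | ZspanN x : Zspan G x -> Zspan G (- x).

Lemma Zspan1 (G : R -> Prop) x : G x -> Zspan G x.
Proof. by move=> Gx; rewrite -(sc_0 scP x); apply: (Zspan_gen 0). Qed.

(** The factor [v^-j] stays in the third hypothesis because closure of a span under negative powers
    of [v] is itself deduced from this lemma. *)
Lemma Zspan_map (h : R -> R) (G G' : R -> Prop) x :
  (forall x y, h (x + y) = h x + h y) -> (forall r x, h (sc r x) = sc r (h x)) ->
  (forall x j, G x -> Zspan G' (sc (- (j : nat)%:Z) (h x))) -> Zspan G x -> Zspan G' (h x).
Proof.
move=> hD hs hG; have h0 : h 0 = 0 by apply: (addrI (h 0)); rewrite -hD !addr0.
elim=> {x} [|j x /hG|x y _ Hx _ Hy|x _ Hx].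
- by rewrite h0; apply: Zspan0.
- by rewrite hs; apply.
- by rewrite hD; apply: ZspanD.
- have -> : h (- x) = - h x by apply: (addrI (h x)); rewrite -hD !subrr.
  exact: ZspanN.
Qed.

Lemma Zspan_sc_le (G : R -> Prop) r x : r <= 0 -> Zspan G x -> Zspan G (sc r x).
Proof.
move=> r0; apply: Zspan_map => [y z|s y|y j Gy]; first exact: (scD scP).
  by rewrite !(scA scP) addrC.
rewrite (scA scP); have -> : - j%:Z + r = - (j + `|r|)%N%:Z by lia.
exact: Zspan_gen.
Qed.

Lemma Zspan_trans (G G' : R -> Prop) x :
  (forall x, G x -> Zspan G' x) -> Zspan G x -> Zspan G' x.
Proof.
move=> GG; apply: (@Zspan_map id) => // y j Gy.
by apply: Zspan_sc_le; [lia | apply: GG].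
Qed.

Lemma ZspanB (G : R -> Prop) x y : Zspan G x -> Zspan G y -> Zspan G (x - y).
Proof. by move=> Gx Gy; apply: ZspanD => //; apply: ZspanN. Qed.

(** With the standard monomials as [G], this is the congruence required between [C_(a,b)] and
    [E_(a,b)]. *)
Definition near (G : R -> Prop) f e := exists2 g, Zspan G g & f = e + sc (-1) g.

Lemma near_refl (G : R -> Prop) f : near G f f.
Proof. by exists 0; [apply: Zspan0 | rewrite sc0r addr0]. Qed.

Lemma near_eq (G : R -> Prop) f e : f = e -> near G f e.
Proof. by move->; apply: near_refl. Qed.

Lemma near_trans (G : R -> Prop) f e e' : near G f e -> near G e e' -> near G f e'.
Proof.
move=> [g Gg ->] [g' Gg' ->]; exists (g' + g); first exact: ZspanD.
by rewrite (scD scP) addrA.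
Qed.

Lemma near_sub (G G' : R -> Prop) f e :
  (forall x, G x -> Zspan G' x) -> near G f e -> near G' f e.
Proof. by move=> GG [g Gg ->]; exists g => //; apply: Zspan_trans Gg. Qed.

Lemma near_addsc (G : R -> Prop) f e r g :
  r < 0 -> Zspan G g -> near G f e -> near G (f + sc r g) e.
Proof.
move=> r0 Gg [h Gh ->]; exists (h + sc (r + 1) g).
  by apply: ZspanD => //; apply: Zspan_sc_le => //; lia.
by rewrite (scD scP) (scA scP) addrA; congr (_ + sc _ _); lia.
Qed.

Lemma near_subsc (G : R -> Prop) f e r g :
  r < 0 -> Zspan G g -> near G f e -> near G (f - sc r g) e.
Proof. by move=> r0 Gg fe; rewrite -scN; apply: near_addsc => //; apply: ZspanN. Qed.

Lemma near_map (h : R -> R) (G G' : R -> Prop) f e :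
  (forall x y, h (x + y) = h x + h y) -> (forall r x, h (sc r x) = sc r (h x)) ->
  (forall x, Zspan G x -> Zspan G' (h x)) -> near G f e -> near G' (h f) (h e).
Proof.
move=> hD hs hG [g Gg ->]; exists (h g); first exact: hG.
by rewrite hD hs.
Qed.

Lemma near_span (G : R -> Prop) f e : near G f e -> Zspan G e -> Zspan G f.
Proof. by move=> [g Gg ->] Ge; apply: ZspanD => //; apply: Zspan_sc_le. Qed.

End Span.

Lemma pospE (x : int) : (posp x)%:Z = Num.max x 0.
Proof. by case: x => n /=; lia. Qed.

Lemma posp_eq (x : int) (n : nat) : Num.max x 0 = n%:Z -> posp x = n.
Proof. by rewrite -pospE; lia. Qed.

(** * Standard monomials of a seed and the shift of seeds *)

Section Frame.
Variables (R : pzRingType) (sc : int -> R -> R).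

(* In a frame [(y0, y1, y2, y3)] of four consecutive cluster variables, [frameE] is the
   standard monomial and [frameN] its analogue with redundant factors. *)
Definition frameN (y0 y1 y2 y3 : R) (a c d b : nat) : R :=
  sc (- ((c%:Z - a%:Z) * (d%:Z - b%:Z))) (y3 ^+ a * y1 ^+ c * y2 ^+ d * y0 ^+ b).

Definition frameE (y0 y1 y2 y3 : R) (a b : int) : R :=
  frameN y0 y1 y2 y3 (posp (- a)) (posp a) (posp b) (posp (- b)).

(** The bounds control powers of [v]: left multiplication by [y3] or right multiplication by [y1]
    contributes at most [v^B], right multiplication by [y0] at most [v^A]. *)
Definition gen_le y0 y1 y2 y3 (A B : nat) x := exists a c d b,
  [/\ (a <= A)%N, (b <= B)%N & x = frameN y0 y1 y2 y3 a c d b].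

Definition gen_E y0 y1 y2 y3 x := exists a b, x = frameE y0 y1 y2 y3 a b.

Hypothesis scP : scaling sc.
Variables (y0 y1 y2 y3 : R) (p r : nat).
Hypotheses (y01 : y0 * y1 = sc 2 (y1 * y0)) (y12 : y1 * y2 = sc 2 (y2 * y1))
  (y23 : y2 * y3 = sc 2 (y3 * y2))
  (y31 : y3 * y1 = sc (- r%:Z) (y2 ^+ r) + 1)
  (y20 : y2 * y0 = sc (- p%:Z) (y1 ^+ p) + 1)
  (y02 : y0 * y2 = sc p%:Z (y1 ^+ p) + 1).
Local Notation N := (frameN y0 y1 y2 y3).
Local Notation E := (frameE y0 y1 y2 y3).
Local Notation GL := (gen_le y0 y1 y2 y3).
Local Notation GE := (gen_E y0 y1 y2 y3).
Local Notation L A B := (Zspan sc (GL A B)).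

Let scM := (scMl scP, scMr scP, scA scP).

(** The exchange relation is applied to the innermost pair [y3 * y1]; for [r > 0] the extra term
    carries a negative power of [v]. *)
Lemma frameN_31 a c d b :
  N a.+1 c.+1 d b = N a c d b + sc (- (r * (a + c + 1))%N%:Z) (N a c (d + r)%N b).
Proof.
rewrite /frameN exprSr [y1 ^+ c.+1]exprS !mulrA -(mulrA (y3 ^+ a)) y31.
rewrite !(@mulrDr R) !(@mulrDl R) mulr1 (scD scP) addrC; congr (_ + _); first by congr sc; lia.
rewrite !scM -(mulrA (y3 ^+ a) (y2 ^+ r)) (qcomm_exp scP r c (qcomm_sym scP y12)).
rewrite !scM (addnC d r) exprD !(@mulrA R).
by congr sc; lia.
Qed.

Lemma frameN_20 a c d b :
  N a c d.+1 b.+1 = N a c d b + sc (- (p * (d + b + 1))%N%:Z) (N a (c + p)%N d b).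
Proof.
rewrite /frameN [y2 ^+ d.+1]exprSr [y0 ^+ b.+1]exprS !mulrA -(mulrA _ y2) y20.
rewrite !(@mulrDr R) !(@mulrDl R) mulr1 (scD scP) addrC; congr (_ + _); first by congr sc; lia.
rewrite !scM -(mulrA _ (y2 ^+ d)) (qcomm_exp scP d p (qcomm_sym scP y12)).
rewrite !scM exprD !(@mulrA R).
by congr sc; lia.
Qed.

Lemma frameN_y3 a c d b : y3 * N a c d b = sc (b%:Z - d%:Z) (N a.+1 c d b).
Proof. by rewrite /frameN exprS !scM !mulrA; congr sc; lia. Qed.

Lemma frameN_y1 a c d b : N a c d b * y1 = sc (b%:Z - d%:Z) (N a c.+1 d b).
Proof.
rewrite /frameN !scM -(@mulrA R) (qcomm_expl scP b y01) !scM !(@mulrA R).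
rewrite -(mulrA _ (y2 ^+ d) y1) (qcomm_expl scP d (qcomm_sym scP y12)) !scM.
by rewrite exprSr !(@mulrA R); congr sc; lia.
Qed.

Lemma frameN_y0 a c d b : N a c d b * y0 = sc (a%:Z - c%:Z) (N a c d b.+1).
Proof. by rewrite /frameN exprSr !scM !mulrA; congr sc; lia. Qed.

Hypotheses (r_gt0 : (0 < r)%N) (p_gt0 : (0 < p)%N).

(** Cancelling a redundant pair keeps the index differences. The extra term has a smaller [a + b],
    so by induction it lies in the lattice, and its power of [v] is negative. *)
Lemma near_frameN a c d b :
  near sc GE (N a c d b) (E (c%:Z - a%:Z) (d%:Z - b%:Z)).
Proof.
have [n] := ubnP (a + b); elim: n a c d b => // n IH a c d b lt_n.
have spanN a' c' d' b' : (a' + b' < n)%N -> Zspan sc GE (N a' c' d' b').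
  move=> lt'; apply: (near_span scP (IH _ _ _ _ lt')).
  by apply: (Zspan1 scP); exists (c'%:Z - a'%:Z), (d'%:Z - b'%:Z).
case: a c lt_n => [|a] [|c] lt_n; last first.
- rewrite frameN_31; apply: (near_addsc scP); [lia | by apply: spanN; lia |].
  have -> : c.+1%:Z - a.+1%:Z = c%:Z - a%:Z by lia.
  by apply: IH; lia.
all: case: d b lt_n => [|d] [|b] lt_n; try
  (rewrite frameN_20; apply: (near_addsc scP); [lia | by apply: spanN; lia |];
   have -> : d.+1%:Z - b.+1%:Z = d%:Z - b%:Z by [lia]; by apply: IH; lia).
(* No redundant pair is left, so the exponents are the positive and negative parts of the
   indices. *)
all: by apply: (near_eq scP); congr frameN; symmetry; apply: posp_eq; lia.
Qed.

Lemma gen_le_span A B x : GL A B x -> Zspan sc GE x.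
Proof.
move=> [a [c [d [b [_ _ ->]]]]]; apply: (near_span scP (near_frameN a c d b)).
by apply: (Zspan1 scP); exists (c%:Z - a%:Z), (d%:Z - b%:Z).
Qed.

Lemma L_frameN A B a c d b : (a <= A)%N -> (b <= B)%N -> L A B (N a c d b).
Proof. by move=> aA bB; apply: (Zspan1 scP); exists a, c, d, b. Qed.

Lemma L_mono A B A' B' x : (A <= A')%N -> (B <= B')%N -> L A B x -> L A' B' x.
Proof.
move=> AA BB; apply: (Zspan_trans scP) => y [a [c [d [b [? ? ->]]]]].
by apply: L_frameN; lia.
Qed.

Lemma L_y3n A B n x : L A B x -> L (A + n) B (sc (- (B * n)%N%:Z) (y3 ^+ n * x)).
Proof.
move=> Lx; elim: n => [|n IH]; first by rewrite addn0 muln0 mul1r (sc_0 scP).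
have -> : sc (- (B * n.+1)%N%:Z) (y3 ^+ n.+1 * x)
  = sc (- B%:Z) (y3 * sc (- (B * n)%N%:Z) (y3 ^+ n * x)).
  by rewrite !scM exprS mulrA; congr sc; lia.
move: IH; apply: (Zspan_map (h := fun x => sc (- B%:Z) (y3 * x))) => [u w|s u|u j].
- by rewrite mulrDr (scD scP).
- by rewrite !scM; congr sc; lia.
move=> [a [c [d [b [? ? ->]]]]]; rewrite frameN_y3 2!(scA scP).
by apply: (Zspan_sc_le scP); [lia | apply: L_frameN; lia].
Qed.

Lemma L_y1n A B n x : L A B x -> L A B (sc (- (B * n)%N%:Z) (x * y1 ^+ n)).
Proof.
move=> Lx; elim: n => [|n IH]; first by rewrite muln0 mulr1 (sc_0 scP).
have -> : sc (- (B * n.+1)%N%:Z) (x * y1 ^+ n.+1)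
  = sc (- B%:Z) (sc (- (B * n)%N%:Z) (x * y1 ^+ n) * y1).
  by rewrite !scM exprSr mulrA; congr sc; lia.
move: IH; apply: (Zspan_map (h := fun x => sc (- B%:Z) (x * y1))) => [u w|s u|u j].
- by rewrite mulrDl (scD scP).
- by rewrite !scM; congr sc; lia.
move=> [a [c [d [b [? ? ->]]]]]; rewrite frameN_y1 2!(scA scP).
by apply: (Zspan_sc_le scP); [lia | apply: L_frameN; lia].
Qed.

Lemma L_y0 A B x : L A B x -> L A B.+1 (sc (- A%:Z) (x * y0)).
Proof.
apply: (Zspan_map (h := fun x => sc (- A%:Z) (x * y0))) => [u w|s u|u j].
- by rewrite mulrDl (scD scP).
- by rewrite !scM; congr sc; lia.
move=> [a [c [d [b [? ? ->]]]]]; rewrite frameN_y0 2!(scA scP).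
by apply: (Zspan_sc_le scP); [lia | apply: L_frameN; lia].
Qed.

(** * Powers of the next cluster variable *)

Variable y4 : R.
Hypotheses (y34 : y3 * y4 = sc 2 (y4 * y3))
  (y42 : y4 * y2 = sc (- p%:Z) (y3 ^+ p) + 1)
  (y2_reg : forall f g, f * y2 = g * y2 -> f = g).

Definition gen_pow x := exists j : nat, x = y2 ^+ j.

(* [y3^n y1^n = \prod_(i < n) (1 + v^(- r (2i + 1)) y2^r)] *)
Lemma y3n_y1n n : exists2 g, Zspan sc gen_pow g & y3 ^+ n * y1 ^+ n = 1 + sc (-1) (g * y2).
Proof.
elim: n => [|n [g Gg IH]].
  by exists 0; [apply: Zspan0 | rewrite mul1r mul0r sc0r // addr0].
have -> : y3 ^+ n.+1 * y1 ^+ n.+1 =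
    y3 ^+ n * y1 ^+ n + sc (- (r * (n + n + 1))%N%:Z) (y3 ^+ n * y1 ^+ n * y2 ^+ r).
  rewrite exprSr [y1 ^+ n.+1]exprS !mulrA -(mulrA (y3 ^+ n)) y31 mulrDr mulrDl mulr1 addrC.
  congr (_ + _); rewrite !scM -(mulrA _ (y2 ^+ r)).
  rewrite (qcomm_exp scP r n (qcomm_sym scP y12)) !scM !mulrA.
  by congr sc; lia.
have [s rs] : exists s, r = s.+1 by exists r.-1; lia.
exists (g + sc (- (r * (n + n + 1))%N%:Z + 1) ((1 + sc (-1) (g * y2)) * y2 ^+ s)).
  apply: ZspanD => //; apply: (Zspan_sc_le scP); first by lia.
  rewrite mulrDl mul1r; apply: ZspanD; first by apply: (Zspan1 scP); exists s.
  rewrite !scM; move: Gg; apply: (Zspan_map (h := fun g => sc (-1) (g * y2 * y2 ^+ s))).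
  - by move=> u w; rewrite !mulrDl (scD scP).
  - by move=> u w; rewrite !scM addrC.
  move=> _ j [k ->]; rewrite !scM -mulrA -exprS -exprD.
  by apply: (Zspan_sc_le scP); [lia | apply: (Zspan1 scP); exists (k + s.+1)%N].
rewrite IH -addrA; congr (1 + _); rewrite [in RHS]mulrDl (scD scP); congr (_ + _).
by rewrite !scM rs exprSr mulrA; congr sc; lia.
Qed.

(** Computing [y4 * y2 * y0] in two ways leaves the remainder [y0 - v^-p y4 y1^p]. Right
    multiplication by [y2] turns it into [1 - y3^p y1^p], from which [y3n_y1n] extracts a factor
    [y2]. *)
Lemma y4E : exists2 g, Zspan sc gen_pow g & y4 = N p 0 0 1 - sc (-1) g.
Proof.
have [g Gg gE] := y3n_y1n p; exists g => //.
have e1 : y4 = sc (- p%:Z) (y3 ^+ p * y0) + y0 - sc (- p%:Z) (y4 * y1 ^+ p).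
  apply: (canRL (addrK _)); have: y4 * (y2 * y0) = y4 * y2 * y0 by rewrite mulrA.
  by rewrite y20 y42 mulrDr mulrDl mulr1 mul1r !scM addrC.
rewrite {1}e1 -addrA; congr (_ + _); first by rewrite /frameN !mulr1; congr sc; lia.
apply: y2_reg; rewrite mulrBl y02 mulNr !scM -mulrA (qcomm_expl scP p y12) !scM mulrA y42.
rewrite (@mulrDl R) (@mul1r R) (scD scP) !scM gE (scD scP) !scM.
have -> : - p%:Z + 2 * p%:Z + - p%:Z = 0 :> int by lia.
have -> : - p%:Z + 2 * p%:Z = p%:Z by lia.
by rewrite !(sc_0 scP) sub0r [1 + _ + _]addrC addrA opprD addrA subrr add0r.
Qed.

(** The two claims are proved together: expanding one factor by [y4E] leaves errors [y4^n y2^j],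
    which the first claim puts in the lattice. *)
Lemma y4n_L n : (forall j, L (p * n) n (y4 ^+ n * y2 ^+ j)) /\
  near sc (GL (p * n) n) (y4 ^+ n) (N (p * n) 0 0 n).
Proof.
have [g Gg gE] := y4E.
elim: n => [|n [IH1 IH2]].
  split=> [j|]; last first.
    rewrite muln0 /frameN !mulr1 (sc_0 scP); exact: near_refl.
  have -> : y4 ^+ 0 * y2 ^+ j = N 0 0 j 0.
    by rewrite /frameN !expr0 !mul1r mulr1 mul0r oppr0 (sc_0 scP).
  by apply: L_frameN.
have LL x : L (p * n) n x -> L (p * n.+1) n.+1 x by apply: L_mono; lia.
have Lx x : L (p * n) n x ->
  L (p * n.+1) n.+1 (sc (- (p * (2 * n + 1))%N%:Z) (y3 ^+ p * x * y0)).
  move=> /L_y0/(L_y3n p); rewrite !scM mulrA.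
  have -> : (p * n + p = p * n.+1)%N by lia.
  by congr (Zspan _ _ (sc _ _)); lia.
have Lg : L (p * n.+1) n.+1 (y4 ^+ n * g).
  move: Gg; apply: (Zspan_map (h := fun g => y4 ^+ n * g)) => [u w|s u|_ k [j ->]].
  - by rewrite mulrDr.
  - by rewrite scM.
  by apply: (Zspan_sc_le scP); [lia | apply: LL].
have e4 : y4 ^+ n.+1 =
    sc (- (p * (2 * n + 1))%N%:Z) (y3 ^+ p * y4 ^+ n * y0) - sc (-1) (y4 ^+ n * g).
  rewrite exprSr {2}gE mulrBr scM; congr (_ - _).
  rewrite /frameN !scM !mulr1 mulrA (qcomm_exp scP n p (qcomm_sym scP y34)) !scM.
  by congr sc; lia.
have ne : near sc (GL (p * n.+1) n.+1) (y4 ^+ n.+1) (N (p * n.+1) 0 0 n.+1).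
  rewrite e4; apply: near_subsc => //.
  have -> : N (p * n.+1) 0 0 n.+1
     = sc (- (p * (2 * n + 1))%N%:Z) (y3 ^+ p * N (p * n) 0 0 n * y0).
    rewrite /frameN !scM !mulr1 !mulrA -exprD -mulrA -exprSr.
    have -> : (p + p * n = p * n.+1)%N by lia.
    by congr sc; lia.
  move: IH2; apply: (near_map (h := fun x => sc (- (p * (2 * n + 1))%N%:Z) (y3 ^+ p * x * y0))).
  - by move=> u w; rewrite mulrDr mulrDl (scD scP).
  - by move=> u w; rewrite !scM addrC.
  - exact: Lx.
split=> // -[|j].
  by rewrite mulr1; apply: near_span ne _ => //; apply: L_frameN; lia.
(* With a factor [y2] present, the pair [y4 * y2] is exchanged, leaving only [n] factors [y4]. *)
rewrite exprSr exprS !mulrA -(mulrA _ y4) y42 mulrDr mulrDl mulr1.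
apply: ZspanD; last exact: LL.
rewrite !scM (qcomm_exp scP n p (qcomm_sym scP y34)) !scM -(@mulrA R).
apply: (L_mono (A := p * n + p) (B := n)); [lia | lia |].
have := L_y3n p (IH1 j); move/(Zspan_sc_le scP (r := - (p * (n + 1))%N%:Z)).
by rewrite scM => H; have := H (ltac:(lia)); congr (Zspan _ _ (sc _ _)); lia.
Qed.

(** For [a >= 0] the monomial involves only [y1], [y2], [y3] and needs reordering. For [a < 0] the
    power of [y4] is replaced by its leading monomial from [y4n_L]; the remaining factor [y3^k] or
    [y1^k], suitably scaled, preserves the lattice. *)
Lemma near_frame_shift a b :
  near sc GE (frameE y1 y2 y3 y4 a b) (E (- b - p%:Z * (posp (- a))%:Z) a).
Proof.
have eqN f x y a' c' d' b' : f = N a' c' d' b' -> x = c'%:Z - a'%:Z -> y = d'%:Z - b'%:Z ->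
    near sc GE f (E x y) by move=> -> -> ->; apply: near_frameN.
have GLE A B x : L A B x -> Zspan sc GE x.
  by apply: (Zspan_trans scP) => ?; apply: gen_le_span.
have [a_ge0|a_lt0] := leP 0 a.
  have [n ->] : exists n : nat, a = n by exists `|a|%N; lia.
  have [b_ge0|b_lt0] := leP 0 b.
    have [k ->] : exists k : nat, b = k by exists `|b|%N; lia.
    apply: (eqN _ _ _ k 0%N n 0%N); last 2 first.
    - by rewrite pospE; lia.
    - by lia.
    rewrite /frameE /frameN !(@posp_eq (- _) 0) /=; [|lia..].
    by rewrite !mulr1 mul1r (qcomm_exp scP n k y23) scM; congr sc; lia.
  have [k ->] : exists k : nat, b = - k%:Z by exists `|b|%N; lia.
  apply: (eqN _ _ _ 0%N k n 0%N); last 2 first.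
  - by rewrite pospE; lia.
  - by lia.
  rewrite /frameE /frameN (@posp_eq (- n%:Z) 0) ?(@posp_eq (- k%:Z) 0)
    ?(@posp_eq (- - k%:Z) k) /=; [|lia..].
  by rewrite !mulr1 !mul1r (qcomm_exp scP n k (qcomm_sym scP y12)) scM; congr sc; lia.
have [M ->] : exists M : nat, a = - M%:Z by exists `|a|%N; lia.
have [_ nM] := y4n_L M.
have [b_ge0|b_lt0] := leP 0 b.
  have [k ->] : exists k : nat, b = k by exists `|b|%N; lia.
  apply: (near_trans scP (e := sc (- (M * k)%N%:Z) (y3 ^+ k * N (p * M) 0 0 M))); last first.
    apply: (eqN _ _ _ (k + p * M)%N 0%N 0%N M); last 2 first.
    - by rewrite pospE; lia.
    - by lia.
    by rewrite /frameN !scM !(@mulrA R) -exprD; congr sc; lia.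
  rewrite [frameE _ _ _ _ _ _](_ : _ = sc (- (M * k)%N%:Z) (y3 ^+ k * y4 ^+ M)); last first.
    rewrite /frameE /frameN (@posp_eq (- - M%:Z) M) ?(@posp_eq (- M%:Z) 0)
      ?(@posp_eq (- k%:Z) 0) /=; [|lia..].
    by rewrite !mulr1 (qcomm_exp scP M k (qcomm_sym scP y34)) scM; congr sc; lia.
  apply: (near_map (h := fun x => sc (- (M * k)%N%:Z) (y3 ^+ k * x)) _ _ _ nM).
  - by move=> u w; rewrite mulrDr (scD scP).
  - by move=> u w; rewrite !scM addrC.
  - by move=> x /(L_y3n k) /GLE.
have [k ->] : exists k : nat, b = - k%:Z by exists `|b|%N; lia.
apply: (near_trans scP (e := sc (- (M * k)%N%:Z) (N (p * M) 0 0 M * y1 ^+ k))); last first.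
  apply: (eqN _ _ _ (p * M)%N k 0%N M); last 2 first.
  - by rewrite pospE; lia.
  - by lia.
  by rewrite /frameN !scM !mulr1 -(@mulrA R) (qcomm_exp scP M k y01) !scM !(@mulrA R);
    congr sc; lia.
rewrite [frameE _ _ _ _ _ _](_ : _ = sc (- (M * k)%N%:Z) (y4 ^+ M * y1 ^+ k)); last first.
  rewrite /frameE /frameN (@posp_eq (- - M%:Z) M) ?(@posp_eq (- M%:Z) 0) ?(@posp_eq (- k%:Z) 0)
    ?(@posp_eq (- - k%:Z) k) /=; [|lia..].
  by rewrite !mulr1; congr sc; lia.
apply: (near_map (h := fun x => sc (- (M * k)%N%:Z) (x * y1 ^+ k)) _ _ _ nM).
- by move=> u w; rewrite mulrDl (scD scP).
- by move=> u w; rewrite !scM addrC.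
- by move=> x /(L_y1n k) /GLE.
Qed.

End Frame.

(** * Cluster sequences *)

Definition mexp (k : int) : nat := if oddz k then 1 else 4.

Lemma mexp_gt0 k : (0 < mexp k)%N. Proof. by rewrite /mexp; case: ifP. Qed.

Lemma mexpN k : mexp (- k) = mexp k. Proof. by rewrite /mexp /oddz abszN. Qed.

Lemma oddzS k : oddz (k + 1) = ~~ oddz k.
Proof. by rewrite /oddz; lia. Qed.

Lemma mexp2 k : mexp (k + 2) = mexp k.
Proof. by rewrite /mexp -[2](_ : 1 + 1 = _ :> int) // addrA !oddzS negbK. Qed.

(* The relations are stable under passing to the converse ring with the sequence [X (- k)]. *)
Record cluster (R : pzRingType) (sc : int -> R -> R) (X : int -> R) : Prop := Cluster {
  cl_comm : forall k, X k * X (k + 1) = sc 2 (X (k + 1) * X k);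
  cl_mut : forall k, X (k - 1) * X (k + 1) = sc (mexp k)%:Z (X k ^+ mexp k) + 1;
  cl_mutV : forall k, X (k + 1) * X (k - 1) = sc (- (mexp k)%:Z) (X k ^+ mexp k) + 1;
  cl_regr : forall k f g, f * X k = g * X k -> f = g;
  cl_regl : forall k f g, X k * f = X k * g -> f = g }.

(** * Reversal of the sequence in the converse ring *)

Section Converse.
Variables (R : pzRingType) (sc : int -> R -> R).
Hypothesis scP : scaling sc.

Lemma converse_exp (x : R) n : (x : R^c) ^+ n = x ^+ n.
Proof. by elim: n => // n IH; rewrite exprS exprSr IH. Qed.

Lemma converse_scaling : @scaling R^c sc.
Proof.
by split; [exact: (scD scP) | exact: (sc_0 scP) | exact: (scA scP) |
  move=> r f g; exact: (scMr scP) | move=> r f g; exact: (scMl scP)].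
Qed.

Lemma converse_cluster X : cluster sc X -> @cluster R^c sc (fun k => X (- k)).
Proof.
move=> XP; split=> k.
- have := cl_comm XP (- (k + 1)); have -> : - (k + 1) + 1 = - k by lia.
  by move=> H; exact: H.
- rewrite converse_exp -(mexpN k); have := cl_mut XP (- k).
  have -> : - k - 1 = - (k + 1) by lia.
  by have -> : - k + 1 = - (k - 1) by lia.
- rewrite converse_exp -(mexpN k); have := cl_mutV XP (- k).
  have -> : - k - 1 = - (k + 1) by lia.
  by have -> : - k + 1 = - (k - 1) by lia.
- by move=> f g; apply: (cl_regl XP).
- by move=> f g; apply: (cl_regr XP).
Qed.

Lemma converse_frameE (y0 y1 y2 y3 : R) a b :
  @frameE R^c sc y0 y1 y2 y3 a b = frameE sc y3 y2 y1 y0 b a.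
Proof.
rewrite /frameE /frameN !converse_exp; congr sc; first by rewrite mulrC.
by rewrite -[RHS]mulrA -[RHS]mulrA.
Qed.

Lemma converse_near (G : R -> Prop) f e : @near R^c sc G f e -> near sc G f e.
Proof.
move=> [g Gg ->]; exists g => //.
by elim: Gg => *; [apply: Zspan0 | apply: Zspan_gen | apply: ZspanD | apply: ZspanN].
Qed.

End Converse.

(** * Passing between neighbouring seeds *)

Section SeedUp.
Variables (R : pzRingType) (sc : int -> R -> R) (X : int -> R).

Definition seedE m := frameE sc (X (m - 1)) (X m) (X (m + 1)) (X (m + 2)).
Definition seedG m := gen_E sc (X (m - 1)) (X m) (X (m + 1)) (X (m + 2)).
Definition clmon (k : int) (c d : nat) : R := sc (- (c%:Z * d%:Z)) (X k ^+ c * X (k + 1) ^+ d).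

Hypotheses (scP : scaling sc) (XP : cluster sc X).

Lemma near_seed_up m a b :
  near sc (seedG m) (seedE (m + 1) a b) (seedE m (- b - (mexp m)%:Z * (posp (- a))%:Z) a).
Proof.
have s2 : m + 1 + 1 = m + 2 by lia.
rewrite /seedE addrK s2.
apply: (near_frame_shift scP (r := mexp (m + 1))); rewrite ?mexp_gt0 //.
- by have := cl_comm XP (m - 1); rewrite subrK.
- exact: cl_comm.
- by have := cl_comm XP (m + 1); rewrite s2.
- by have := cl_mutV XP (m + 1); rewrite s2 addrK.
- exact: cl_mutV.
- exact: cl_mut.
- by have := cl_comm XP (m + 2); congr (_ * X _ = sc 2 (X _ * _)); lia.
(* Exchange exponents have period 2, so the relations at [m] and [m + 2] share the exponent [p]. *)
- have := cl_mutV XP (m + 2); rewrite mexp2.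
  by congr (X _ * X _ = _); lia.
- exact: (cl_regr XP).
Qed.

End SeedUp.

Section SeedReach.
Variables (R : pzRingType) (sc : int -> R -> R) (X : int -> R).
Hypotheses (scP : scaling sc) (XP : cluster sc X).

(** This is [near_seed_up] in the converse ring for the sequence [X (- k)]: seed [m] becomes seed
    [- m - 1], with its two indices swapped. *)
Lemma near_seed_down m a b :
  near sc (seedG sc X m) (seedE sc X (m - 1) a b)
    (seedE sc X m b (- a - (mexp (m + 1))%:Z * (posp (- b))%:Z)).
Proof.
have := near_seed_up (converse_scaling scP) (converse_cluster XP) (- m - 1) b a.
rewrite /seedE !converse_frameE -opprD mexpN => /converse_near [g Gg e].
exists g.
  move: Gg; apply: (Zspan_trans scP) => x [a' [b' ->]]; apply: (Zspan1 scP).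
  exists b', a'; rewrite converse_frameE /seedE.
  by congr (frameE _ (X _) (X _) (X _) (X _)); lia.
have := e.
congr (frameE _ (X _) (X _) (X _) (X _) _ _ = frameE _ (X _) (X _) (X _) (X _) _ _ + _); lia.
Qed.

Definition near_at m f a b := near sc (seedG sc X m) f (seedE sc X m a b).

Lemma seedE_clmon m c d : seedE sc X m c%:Z d%:Z = clmon sc X m c d.
Proof.
rewrite /seedE /frameE /frameN /clmon !(@posp_eq (- _) 0) /=; [|lia..].
by rewrite mul1r mulr1; congr sc; lia.
Qed.

(** The error term changes lattice too: each standard monomial of seed [m + 1] is congruent to one
    of seed [m], hence lies in the span of the latter. *)
Lemma near_at_up m f a b : near_at (m + 1) f a b ->
  near_at m f (- b - (mexp m)%:Z * (posp (- a))%:Z) a.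
Proof.
move=> nf; apply: (near_trans scP) (near_seed_up scP XP m a b).
move: nf; apply: (near_sub scP) => x [a' [b' ->]].
apply: (near_span scP (near_seed_up scP XP m a' b')); apply: (Zspan1 scP).
by exists (- b' - (mexp m)%:Z * (posp (- a'))%:Z), a'.
Qed.

Lemma near_at_down m f a b : near_at (m - 1) f a b ->
  near_at m f b (- a - (mexp (m + 1))%:Z * (posp (- b))%:Z).
Proof.
move=> nf; apply: (near_trans scP) (near_seed_down m a b).
move: nf; apply: (near_sub scP) => x [a' [b' ->]].
apply: (near_span scP (near_seed_down m a' b')); apply: (Zspan1 scP).
by exists b', (- a' - (mexp (m + 1))%:Z * (posp (- b'))%:Z).
Qed.

(** In seed [k] the monomial is itself standard; the shifts carry it to seed [m] by induction on the
    distance. *)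
Lemma near_clmon k c d m : exists a b, near_at m (clmon sc X k c d) a b.
Proof.
have [n] : exists n : nat, (`|k - m| = n)%N by exists `|k - m|%N.
elim: n m => [|n IH] m mn.
  have -> : m = k by lia.
  by exists c%:Z, d%:Z; rewrite /near_at seedE_clmon; apply: near_refl.
have [km|km] := leP m k.
  have [|a [b /near_at_up H]] := IH (m + 1); first by lia.
  by eexists; eexists; apply: H.
have [|a [b /near_at_down H]] := IH (m - 1); first by lia.
by eexists; eexists; apply: H.
Qed.

(** * Indices reached by cluster monomials *)

Definition reached m a b := exists k c d, near_at m (clmon sc X k c d) a b.

(** The shift of indices from seed [m + 1] to seed [m] is bijective, and the hypothesis is stated at
    the preimage of [(a, b)]. *)
Lemma reached_up m a b : reached (m + 1) b (- a - (mexp m)%:Z * (posp (- b))%:Z) ->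
  reached m a b.
Proof.
move=> [k [c [d /near_at_up H]]]; exists k, c, d; move: H.
by congr near_at; lia.
Qed.

Lemma reached_down m a b :
  reached (m - 1) (- b - (mexp (m + 1))%:Z * (posp (- a))%:Z) a -> reached m a b.
Proof.
move=> [k [c [d /near_at_down H]]]; exists k, c, d; move: H.
by congr near_at; lia.
Qed.

Lemma reached_pos m a b : 0 <= a -> 0 <= b -> reached m a b.
Proof.
case: a b => [c|//] [d|//] _ _; exists m, c, d; rewrite /near_at seedE_clmon; exact: near_refl.
Qed.

Lemma reached_a_pos m a b : 0 <= a -> reached m a b.
Proof.
move=> a0; have [b0|b0] := leP 0 b; first exact: reached_pos.
by apply: reached_down; apply: reached_pos; rewrite ?pospE; lia.
Qed.

Lemma reached_b_pos m a b : 0 <= b -> reached m a b.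
Proof.
move=> b0; have [a0|a0] := leP 0 a; first exact: reached_pos.
by apply: reached_up; apply: reached_pos; rewrite ?pospE; lia.
Qed.

(* Two mutations act on the indices [(-i, -j)], [j <> 2i], by linear maps that decrease [i]
   until the index leaves the third quadrant. *)
Lemma reached_all m a b : oddz m -> (0 <= a) || (b != 2 * a) -> reached m a b.
Proof.
have [n] := ubnP `|a|%N; elim: n m a b => // n IH m a b an om ab.
have [a0|a0] := leP 0 a; first exact: reached_a_pos.
have [b0|b0] := leP 0 b; first exact: reached_b_pos.
have e0 : mexp m = 1%N by rewrite /mexp om.
have e1 : mexp (m + 1) = 4%N by rewrite /mexp oddzS om.
have [lt|ge] := ltP (2 * a) b.
  apply: reached_up; rewrite pospE e0.
  have [?|?] := leP 0 (- a - 1%:Z * Num.max (- b) 0); first exact: reached_b_pos.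
  apply: reached_up; rewrite pospE e1.
  set b' := (X in reached _ _ X).
  have [?|?] := leP 0 b'; first exact: reached_b_pos.
  (* For [(a, b) = (-i, -j)] the pair [(i, j)] has become [(j - i, 3j - 4i)]: [j - 2i] is unchanged
     and [j < 2i] gives [j - i < i]. *)
  by apply: IH; [lia | by rewrite !oddzS om | lia].
have {}ge : b < 2 * a by lia.
apply: reached_down; rewrite pospE e1.
set b' := (X in reached _ X _).
have [?|?] := leP 0 b'; first exact: reached_a_pos.
apply: reached_down; rewrite pospE subrK e0.
set b'' := (X in reached _ X _).
have [?|?] := leP 0 b''; first exact: reached_a_pos.
(* Here [(i, j)] has become [(3i - j, 4i - j)], again with [j - 2i] unchanged, and [j > 2i] gives
   [3i - j < i]. *)
apply: IH; [lia | | lia].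
by move: (oddzS (m - 1 - 1)) (oddzS (m - 1)); rewrite !subrK om => ->; rewrite negbK.
Qed.

End SeedReach.

(** * The element [X_delta] *)

Section DeltaLocal.
Variables (R : pzRingType) (sc : int -> R -> R).
Hypothesis scP : scaling sc.
Let scM := (scMl scP, scMr scP, scA scP).
Variables x0 x1 x2 x3 x4 x5 x6 : R.
Hypotheses (x12 : x1 * x2 = sc 2 (x2 * x1)) (x23 : x2 * x3 = sc 2 (x3 * x2))
  (x34 : x3 * x4 = sc 2 (x4 * x3)) (x45 : x4 * x5 = sc 2 (x5 * x4))
  (x02 : x0 * x2 = sc 1 x1 + 1) (x13 : x1 * x3 = sc 4 (x2 ^+ 4) + 1)
  (x31 : x3 * x1 = sc (-4) (x2 ^+ 4) + 1) (x42 : x4 * x2 = sc (-1) x3 + 1)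
  (x53 : x5 * x3 = sc (-4) (x4 ^+ 4) + 1)
  (x64 : x4 * x6 = sc 1 x5 + 1)
  (x2_reg : forall f g, f * x2 = g * x2 -> f = g)
  (x3_reg : forall f g, f * x3 = g * x3 -> f = g)
  (x4_reg : forall f g, x4 * f = x4 * g -> f = g).

(** An expression for [X_delta] in three successive even-indexed cluster variables. *)
Definition delta_of y0 y2 y4 := sc (-1) (y4 * y0) - sc (-3) (y2 ^+ 2).

(** After right multiplication by the regular element [x2], exchange relations evaluate both
    sides. *)
Lemma x4x1 : sc (-1) (x4 * x1) = x0 + sc (-4) (x2 ^+ 3).
Proof.
apply: x2_reg; rewrite mulrDl !scM -exprSr x02 -mulrA x12 scM mulrA x42 !scM.
by rewrite mulrDl mul1r scM x31 !(scD scP) !scM !(sc_0 scP); abel.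
Qed.

Lemma x5x2 : sc (-1) (x5 * x2) = x6 + sc (-4) (x4 ^+ 3).
Proof.
apply: x4_reg; rewrite mulrDr !scM -exprS x64 mulrA x45 scM -mulrA x42 !scM.
by rewrite mulrDr mulr1 scM x53 !(scD scP) !scM !(sc_0 scP); abel.
Qed.

Lemma delta_of_x2 : delta_of x0 x2 x4 * x2 = sc (-1) x4 + sc 1 x0.
Proof.
rewrite /delta_of mulrBl !scM -mulrA x02 -exprSr mulrDr mulr1 scM (scD scP) scM.
have := congr1 (sc 1) x4x1; rewrite (scD scP) !scM /= => ->.
by abel.
Qed.

Lemma x44x22 : x4 ^+ 2 * x2 ^+ 2 = sc (-4) (x3 ^+ 2) + sc (-3) x3 + sc (-1) x3 + 1.
Proof.
rewrite !expr2 mulrA -(mulrA x4) x42 mulrDr mulr1 scM (qcomm_sym scP x34) scM.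
rewrite mulrDl scM -mulrA x42 mulrDr mulr1 !scM (scD scP) !scM.
by rewrite -expr2; abel.
Qed.

(** Eliminating [x0] through [x4x1] brings in [x1], which the factor [x3] then exchanges. *)
Lemma delta_of_x3 : delta_of x0 x2 x4 * x3 = sc (-2) (x4 ^+ 2) + sc 2 (x2 ^+ 2).
Proof.
have x223 : x2 ^+ 2 * x3 = sc 4 (x3 * x2 ^+ 2) by rewrite (qcomm_expl scP 2 x23).
have e0 : sc (-1) x0 = sc (-2) (x4 * x1) - sc (-5) (x2 ^+ 3).
  have := congr1 (sc (-1)) x4x1; rewrite (scD scP) !scM /= => ->.
  by abel.
have e : delta_of x0 x2 x4 =
    sc (-2) (x4 ^+ 2 * x1) - sc (-6) (x3 * x2 ^+ 2) - sc (-5) (x2 ^+ 2) - sc (-3) (x2 ^+ 2).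
  rewrite /delta_of -(scMr scP) e0 mulrBr !scM mulrA -expr2.
  have -> : x4 * x2 ^+ 3 = sc (-1) (x3 * x2 ^+ 2) + x2 ^+ 2.
    by rewrite exprS mulrA x42 mulrDl mul1r scM.
  by rewrite (scD scP) scM; abel.
rewrite e !mulrBl !scM -(mulrA _ x1) -(mulrA x3) x13 x223 !scM mulrDr mulr1 (scD scP) !scM.
have -> : x4 ^+ 2 * x2 ^+ 4 = x4 ^+ 2 * x2 ^+ 2 * x2 ^+ 2 by rewrite -mulrA -exprD.
rewrite x44x22 !mulrDl mul1r !scM !(scD scP) !scM (mulrA x3) -expr2 /=.
by abel.
Qed.

Lemma delta_of_next_x3 : delta_of x2 x4 x6 * x3 = sc (-2) (x4 ^+ 2) + sc 2 (x2 ^+ 2).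
Proof.
have x223 : x2 ^+ 2 * x3 = sc 4 (x3 * x2 ^+ 2) by rewrite (qcomm_expl scP 2 x23).
have e0 : sc (-1) x6 = sc (-2) (x5 * x2) - sc (-5) (x4 ^+ 3).
  have := congr1 (sc (-1)) x5x2; rewrite (scD scP) !scM /= => ->.
  by abel.
have e : delta_of x2 x4 x6 =
    sc (-2) (x5 * x2 ^+ 2) - sc (-6) (x4 ^+ 2 * x3) - sc (-5) (x4 ^+ 2) - sc (-3) (x4 ^+ 2).
  rewrite /delta_of -(scMl scP) e0 mulrBl !scM -mulrA -expr2.
  have -> : x4 ^+ 3 * x2 = sc (-1) (x4 ^+ 2 * x3) + x4 ^+ 2.
    by rewrite exprSr -mulrA x42 mulrDr mulr1 scM.
  by rewrite (scD scP) scM; abel.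
rewrite e !mulrBl !scM -(mulrA x5) -(mulrA _ x3 x3) x223 !scM (mulrA x5) x53.
rewrite mulrDl mul1r (scD scP) !scM.
have -> : x4 ^+ 4 * x2 ^+ 2 = x4 ^+ 2 * (x4 ^+ 2 * x2 ^+ 2) by rewrite mulrA -exprD.
rewrite x44x22 !mulrDr mulr1 !scM !(scD scP) !scM -expr2 /=.
by abel.
Qed.

(** Both elements have the same product with the regular element [x3]; hence the choice of even
    index does not matter. *)
Lemma delta_of_next : delta_of x2 x4 x6 = delta_of x0 x2 x4.
Proof. by apply: x3_reg; rewrite delta_of_x3 delta_of_next_x3. Qed.

End DeltaLocal.

Fixpoint chebr (R : pzRingType) (x : R) (n : nat) : R :=
  match n with
  | 0 => 1
  | 1 => x
  | (m.+1 as n').+1 => chebr x n' * x - chebr x m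
  end.

Lemma chebrSS (R : pzRingType) (x : R) n : chebr x n.+2 = chebr x n.+1 * x - chebr x n.
Proof. by []. Qed.

Lemma chebr_comm (R : pzRingType) (x : R) n : GRing.comm x (chebr x n).
Proof.
suff: GRing.comm x (chebr x n) /\ GRing.comm x (chebr x n.+1) by case.
elim: n => [|n [IH1 IH2]]; first by split; [apply: commr1 | apply: commr_refl].
by split=> //; rewrite chebrSS; apply: commrB => //; apply: commrM.
Qed.

(** * Chebyshev polynomials in [X_delta] and products of cluster variables *)

Section Delta.
Variables (R : pzRingType) (sc : int -> R -> R) (X : int -> R).
Hypotheses (scP : scaling sc) (XP : cluster sc X).
Let scM := (scMl scP, scMr scP, scA scP).

Definition delta k := delta_of sc (X (k - 2)) (X k) (X (k + 2)).

Lemma cl_mut_odd k : oddz k -> X (k - 1) * X (k + 1) = sc 1 (X k) + 1.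
Proof. by move=> ok; rewrite (cl_mut XP) /mexp ok expr1. Qed.
Lemma cl_mutV_odd k : oddz k -> X (k + 1) * X (k - 1) = sc (-1) (X k) + 1.
Proof. by move=> ok; rewrite (cl_mutV XP) /mexp ok expr1. Qed.
Lemma cl_mut_even k : ~~ oddz k -> X (k - 1) * X (k + 1) = sc 4 (X k ^+ 4) + 1.
Proof. by move=> ok; rewrite (cl_mut XP) /mexp (negPf ok). Qed.
Lemma cl_mutV_even k : ~~ oddz k -> X (k + 1) * X (k - 1) = sc (-4) (X k ^+ 4) + 1.
Proof. by move=> ok; rewrite (cl_mutV XP) /mexp (negPf ok). Qed.

Lemma delta_relations k : ~~ oddz k ->
  [/\ delta k * X k = sc (-1) (X (k + 2)) + sc 1 (X (k - 2)),
      delta k * X (k + 1) = sc (-2) (X (k + 2) ^+ 2) + sc 2 (X k ^+ 2) &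
      delta (k + 2) = delta k].
Proof.
move=> ek.
have c i j : j = i + 1 -> X i * X j = sc 2 (X j * X i) by move->; apply: (cl_comm XP).
have om1 : oddz (k - 1) by have := oddzS (k - 1); rewrite subrK => H; rewrite H negbK in ek.
have op1 : oddz (k + 1) by rewrite oddzS.
have ep2 : ~~ oddz (k + 2).
  by have := oddzS (k + 1); rewrite -!addrA /= => ->; rewrite op1.
have op3 : oddz (k + 3).
  by have := oddzS (k + 2); rewrite -!addrA /= => ->.
have x02 : X (k - 2) * X k = sc 1 (X (k - 1)) + 1.
  by have := cl_mut_odd om1; congr (X _ * X _ = _); lia.
have x13 : X (k - 1) * X (k + 1) = sc 4 (X k ^+ 4) + 1 by apply: cl_mut_even.
have x31 : X (k + 1) * X (k - 1) = sc (-4) (X k ^+ 4) + 1 by apply: cl_mutV_even.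
have x42 : X (k + 2) * X k = sc (-1) (X (k + 1)) + 1.
  by have := cl_mutV_odd op1; congr (X _ * X _ = _); lia.
have x53 : X (k + 3) * X (k + 1) = sc (-4) (X (k + 2) ^+ 4) + 1.
  by have := cl_mutV_even ep2; congr (X _ * X _ = _); lia.
have x46 : X (k + 2) * X (k + 4) = sc 1 (X (k + 3)) + 1.
  by have := cl_mut_odd op3; congr (X _ * X _ = _); lia.
have x12 : X (k - 1) * X k = sc 2 (X k * X (k - 1)) by apply: c; lia.
have x23 : X k * X (k + 1) = sc 2 (X (k + 1) * X k) by apply: c; lia.
have x34 : X (k + 1) * X (k + 2) = sc 2 (X (k + 2) * X (k + 1)) by apply: c; lia.
have x45 : X (k + 2) * X (k + 3) = sc 2 (X (k + 3) * X (k + 2)) by apply: c; lia.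
split; rewrite /delta.
- exact: (delta_of_x2 scP x12 x02 x31 x42 (cl_regr XP (k := k))).
- exact: (delta_of_x3 scP x12 x23 x34 x02 x13 x31 x42 (cl_regr XP (k := k))).
have -> : k + 2 - 2 = k by lia.
have -> : k + 2 + 2 = k + 4 by lia.
exact: (delta_of_next scP x12 x23 x34 x45 x02 x13 x31 x42 x53 x46
  (cl_regr XP (k := k)) (cl_regr XP (k := k + 1)) (cl_regl XP (k := k + 2))).
Qed.

Definition delta2 := delta 2.

Lemma oddz_even (n : nat) : ~~ oddz (2 * n%:Z).
Proof. by rewrite /oddz; lia. Qed.

Lemma deltaE (n : nat) : delta (2 * n%:Z + 2) = delta2.
Proof.
elim: n => [|n IH] //; rewrite -IH.
have -> : 2 * n.+1%:Z + 2 = 2 * n%:Z + 2 + 2 by lia.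
have [] // := @delta_relations (2 * n%:Z + 2).
by have := oddz_even n.+1; congr (~~ oddz _); lia.
Qed.

Lemma delta2_even (n : nat) :
  delta2 * X (2 * n%:Z + 2) = sc (-1) (X (2 * n%:Z + 4)) + sc 1 (X (2 * n%:Z)).
Proof.
have [|+ _ _] := @delta_relations (2 * n%:Z + 2).
  by have := oddz_even n.+1; congr (~~ oddz _); lia.
by rewrite deltaE addrK => ->; congr (sc _ (X _) + _); lia.
Qed.

Lemma delta2_odd (n : nat) :
  delta2 * X (2 * n%:Z + 3) = sc (-2) (X (2 * n%:Z + 4) ^+ 2) + sc 2 (X (2 * n%:Z + 2) ^+ 2).
Proof.
have [|_ + _] := @delta_relations (2 * n%:Z + 2).
  by have := oddz_even n.+1; congr (~~ oddz _); lia.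
rewrite deltaE; congr (_ * X _ = sc _ (X _ ^+ _) + _); lia.
Qed.

(** Squaring the even-indexed variables gives one three-term recursion for all indices, up to a
    multiple of [v + v^-1]. *)
Definition clY (n : nat) : R := if odd n then X n else X n ^+ 2.

Lemma delta2_clY (n : nat) : exists c : nat,
  delta2 * clY n.+2 = sc (-2) (clY n.+3) + sc 2 (clY n.+1) + (sc 1 1 + sc (-1) 1) *+ c.
Proof.
have [k] : exists k, (n = k.*2) \/ (n = k.*2.+1).
  by exists n./2; have := odd_double_half n; case: (odd n); [right|left]; lia.
case=> ->; rewrite /clY /= ?odd_double /=.
  exists 1%N; rewrite expr2 mulrA.
  have -> : k.*2.+2%:Z = 2 * k%:Z + 2 by lia.
  have -> : k.*2.+3%:Z = 2 * k%:Z + 3 by lia.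
  have -> : k.*2.+1%:Z = 2 * k%:Z + 1 by lia.
  rewrite delta2_even mulrDl !scM mulr1n.
  have o1 : oddz (2 * k%:Z + 1) by rewrite oddzS oddz_even.
  have o3 : oddz (2 * k%:Z + 3) by rewrite /oddz; lia.
  have -> : X (2 * k%:Z + 4) * X (2 * k%:Z + 2) = sc (-1) (X (2 * k%:Z + 3)) + 1.
    by have := cl_mutV_odd o3; congr (X _ * X _ = _); lia.
  have -> : X (2 * k%:Z) * X (2 * k%:Z + 2) = sc 1 (X (2 * k%:Z + 1)) + 1.
    by have := cl_mut_odd o1; congr (X _ * X _ = _); lia.
  by rewrite !(scD scP) !scM; abel.
exists 0%N; rewrite mulr0n addr0.
have -> : k.*2.+3%:Z = 2 * k%:Z + 3 by lia.
have -> : k.*2.+4%:Z = 2 * k%:Z + 4 by lia.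
have -> : k.*2.+2%:Z = 2 * k%:Z + 2 by lia.
exact: delta2_odd.
Qed.

(** This power of [v] turns [delta2_even] into the Chebyshev recursion. *)
Definition clprod (n : nat) : R := sc (- n%:Z) (X (2 * n%:Z + 2) * X 0).

Lemma clprodSS n : clprod n.+2 = delta2 * clprod n.+1 - clprod n.
Proof.
rewrite /clprod !scM mulrA.
have := delta2_even n.+1; have -> : 2 * n.+1%:Z = 2 * n%:Z + 2 by lia.
move=> ->; rewrite (@mulrDl R) (scD scP) !scM.
have -> : 2 * n.+2%:Z + 2 = 2 * n%:Z + 2 + 4 by lia.
have -> : - n.+1%:Z + -1 = - n.+2%:Z by lia.
have -> : - n.+1%:Z + 1 = - n%:Z by lia.
by abel.
Qed.

Definition genS (n : nat) x := exists2 j, (j < n)%N & x = chebr delta2 j.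

Lemma delta2_genS n x : Zspan sc (genS n) x -> Zspan sc (genS n.+1) (delta2 * x).
Proof.
apply: (Zspan_map (h := fun x => delta2 * x)) => [u w|r u|_ j [i lt_i ->]].
- exact: mulrDr.
- by rewrite scM.
apply: (Zspan_sc_le scP); first by lia.
case: i lt_i => [|i] lt_i; first by rewrite mulr1; apply: (Zspan1 scP); exists 1%N.
have -> : delta2 * chebr delta2 i.+1 = chebr delta2 i.+2 + chebr delta2 i.
  by rewrite chebrSS chebr_comm; abel.
by apply: ZspanD; apply: (Zspan1 scP); [exists i.+2 | exists i] => //; lia.
Qed.

(** Both sequences satisfy the same recursion. The lower [clY] term produced by [delta2_clY] cancels
    the one in [clprod n], so only its constants feed [U]. *)
Lemma clprod_cheb n : exists2 U, Zspan sc (genS n) U &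
  clprod n = chebr delta2 n + sc (- (2 * n + 1)%N%:Z) (clY n.+1) + sc (-1) U.
Proof.
have genS_mono m m' x : (m <= m')%N -> Zspan sc (genS m) x -> Zspan sc (genS m') x.
  move=> le_m; apply: (Zspan_trans scP) => _ [j lt_j ->].
  by apply: (Zspan1 scP); exists j => //; lia.
suff: (exists2 U, Zspan sc (genS n) U &
    clprod n = chebr delta2 n + sc (- (2 * n + 1)%N%:Z) (clY n.+1) + sc (-1) U) /\
  (exists2 U, Zspan sc (genS n.+1) U &
    clprod n.+1 = chebr delta2 n.+1 + sc (- (2 * n.+1 + 1)%N%:Z) (clY n.+2) + sc (-1) U) by case.
elim: n => [|n [[U0 GU0 E0] [U1 GU1 E1]]].
  split; exists 0; rewrite ?(sc0r scP) ?addr0; try exact: Zspan0.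
    rewrite /clprod /clY (sc_0 scP) [LHS](_ : _ = X (1 + 1) * X (1 - 1)) // cl_mutV_odd //.
    exact: addrC.
  rewrite /clprod /clY /= /delta2 /delta /delta_of.
  by rewrite subrK.
split; first by exists U1.
have [c DY] := delta2_clY n.
(* The last summand is the constant [c (v + v^-1) v^-(2n+3)] with one factor [v^-1] taken out. *)
exists (delta2 * U1 - U0 + (sc (- (2 * n + 1)%N%:Z) 1 + sc (- (2 * n + 3)%N%:Z) 1) *+ c).
  apply: ZspanD; first apply: ZspanB.
  - exact: delta2_genS.
  - by apply: genS_mono GU0; lia.
  elim: c {DY} => [|c IH]; first by rewrite mulr0n; apply: Zspan0.
  rewrite mulrS; apply: ZspanD => //.
  by apply: ZspanD; apply: Zspan_gen; exists 0%N.
rewrite clprodSS E0 E1 !mulrDr !scM DY chebrSS (chebr_comm delta2 n.+1) !(scD scP) !(scN scP) !scM.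
have scMn r x : sc r (x *+ c) = sc r x *+ c.
  elim: c {DY} => [|c IH]; first by rewrite !mulr0n sc0r.
  by rewrite !mulrS (scD scP) IH.
rewrite !scMn !(scD scP) !scM.
have -> : - (2 * n.+1 + 1)%N%:Z + -2 = - (2 * n.+2 + 1)%N%:Z by lia.
have -> : - (2 * n.+1 + 1)%N%:Z + 2 = - (2 * n + 1)%N%:Z by lia.
have -> : - (2 * n.+1 + 1)%N%:Z + 1 = -1 + - (2 * n + 1)%N%:Z by lia.
have -> : - (2 * n.+1 + 1)%N%:Z + -1 = -1 + - (2 * n + 3)%N%:Z by lia.
by abel.
Qed.

Lemma clY_span n : Zspan sc (seedG sc X 1) (clY n).
Proof.
have [c ->] : exists c, clY n = clmon sc X n c 0.
  rewrite /clY /clmon; case: (odd n); [exists 1%N | exists 2%N].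
    by rewrite expr1 mulr1 (sc_0 scP).
  by rewrite mulr1 (sc_0 scP).
have [a [b nab]] := near_clmon scP XP n c 0 1.
by apply: (near_span scP nab); apply: (Zspan1 scP); exists a, b.
Qed.

(** Strong induction: [U] involves only [S_j] with [j < n], already known to lie in the lattice, and
    [clY] lies there as a cluster monomial. *)
Lemma near_cheb :
  (forall n : nat, near sc (seedG sc X 1) (clprod n) (seedE sc X 1 (- n%:Z) (- (2 * n%:Z)))) ->
  forall n : nat, near sc (seedG sc X 1) (chebr delta2 n) (seedE sc X 1 (- n%:Z) (- (2 * n%:Z))).
Proof.
move=> nP; elim/ltn_ind => n IH.
have [U GU PE] := clprod_cheb n.
have -> : chebr delta2 n = clprod n - sc (-1) U - sc (- (2 * n + 1)%N%:Z) (clY n.+1).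
  by rewrite PE; abel.
apply: (near_subsc scP); [lia | exact: clY_span |].
apply: (near_subsc scP) => //.
move: GU; apply: (Zspan_trans scP) => _ [j lt_j ->].
apply: (near_span scP (IH j lt_j)); apply: (Zspan1 scP).
by exists (- j%:Z), (- (2 * j%:Z)).
Qed.

(** Two shifts from seed [m + 2] send [(-n, 1 - 2n)] to [(-1 - 2n, -n)] and then to
    [(-n - 1, -1 - 2n)]. *)
Lemma near_X_even (n : nat) (m : int) : oddz m ->
  near_at sc X m (X (m + 2 * n%:Z + 1)) (- n%:Z) (1 - 2 * n%:Z).
Proof.
elim: n m => [|n IH] m om.
  have -> : X (m + 2 * 0%:Z + 1) = seedE sc X m 0%N%:Z 1%N%:Z.
    rewrite seedE_clmon /clmon mul1r expr1 mul0r oppr0 (sc_0 scP).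
    by congr X; lia.
  exact: (near_refl scP).
have e0 : mexp m = 1%N by rewrite /mexp om.
have e1 : mexp (m + 1) = 4%N by rewrite /mexp oddzS om.
have := IH (m + 1 + 1); rewrite !oddzS om => /(_ isT).
move=> /(near_at_up scP XP) /(near_at_up scP XP); rewrite e0 e1 !pospE.
by congr near_at; [congr X; lia | lia | lia].
Qed.

(* Right multiplication by [v^-n X_0] preserves the lattice generated by the [E_(a,b)] with
   [-n <= a]; this is why truncation in the [X_1]-degree is needed. *)
Lemma near_clprod (n : nat) g :
  Zspan sc (fun x => exists a b, - n%:Z <= a /\ x = seedE sc X 1 a b) g ->
  X (2 * n%:Z + 2) = seedE sc X 1 (- n%:Z) (1 - 2 * n%:Z) + sc (-1) g ->
  near sc (seedG sc X 1) (clprod n) (seedE sc X 1 (- n%:Z) (- (2 * n%:Z))).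
Proof.
move=> Gg XE.
have nN a c d b : near sc (seedG sc X 1)
    (frameN sc (X (1 - 1)) (X 1) (X (1 + 1)) (X (1 + 2)) a c d b)
    (seedE sc X 1 (c%:Z - a%:Z) (d%:Z - b%:Z)).
  apply: (near_frameN scP (p := mexp 1) (r := mexp (1 + 1))); rewrite ?mexp_gt0 //.
  - exact: (cl_comm XP).
  - exact: (cl_mutV XP (1 + 1)).
  - exact: (cl_mutV XP 1).
have spN a c d b : Zspan sc (seedG sc X 1)
    (frameN sc (X (1 - 1)) (X 1) (X (1 + 1)) (X (1 + 2)) a c d b).
  apply: (near_span scP (nN _ _ _ _)); apply: (Zspan1 scP).
  by exists (c%:Z - a%:Z), (d%:Z - b%:Z).
rewrite /clprod XE mulrDl scM (scD scP) (scA scP) addrC -[- n%:Z + -1]addrC -(scA scP) addrC.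
apply: (near_addsc scP) => //.
  move: Gg; apply: (Zspan_map (h := fun g => sc (- n%:Z) (g * X 0))).
  - by move=> u w; rewrite mulrDl (scD scP).
  - by move=> r u; rewrite !scM addrC.
  move=> _ j [a [b [a_ge ->]]].
  rewrite /seedE /frameE (frameN_y0 scP) 2!(scA scP).
  by apply: (Zspan_sc_le scP) => //; rewrite !pospE; lia.
(* At first index [-n], multiplication by [X 0] contributes exactly [v^n], which cancels the
   normalising power. *)
rewrite /seedE /frameE (frameN_y0 scP) (scA scP) !pospE.
have -> : - n%:Z + (Num.max (- - n%:Z) 0 - Num.max (- n%:Z) 0) = 0 by lia.
rewrite (sc_0 scP); move: (nN (posp (- - n%:Z)) (posp (- n%:Z))
  (posp (1 - 2 * n%:Z)) (posp (- (1 - 2 * n%:Z))).+1).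
by rewrite intS !pospE; congr (near _ _ _ (seedE _ _ _ _ _)); lia.
Qed.

End Delta.

(** * The quantum torus as a domain *)

Lemma qaddE (f g : qtorus) k : qadd f g k = f k + g k.
Proof.
rewrite fsfunE; case: ifPn => //; rewrite in_fsetU negb_or !memNfinsupp.
by case/andP=> /eqP-> /eqP->; rewrite addr0.
Qed.

Lemma qoppE (f : qtorus) k : qopp f k = - f k.
Proof.
by rewrite fsfunE; case: ifPn => //; rewrite memNfinsupp => /eqP->; rewrite oppr0.
Qed.

Lemma qzeroE k : qzero k = 0.
Proof. by rewrite fsfunE in_fset0. Qed.

Lemma qmonoE c k l : qmono c k l = if l == k then c else 0.
Proof. by rewrite fsfunE inE; case: eqP. Qed.

Fact qaddA : associative qadd.
Proof. by move=> f g h; apply/fsfunP => k; rewrite !qaddE addrA. Qed.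
Fact qaddC : commutative qadd.
Proof. by move=> f g; apply/fsfunP => k; rewrite !qaddE addrC. Qed.
Fact qadd0 : left_id qzero qadd.
Proof. by move=> f; apply/fsfunP => k; rewrite qaddE qzeroE add0r. Qed.
Fact qaddN : left_inverse qzero qopp qadd.
Proof. by move=> f; apply/fsfunP => k; rewrite qaddE qoppE qzeroE addNr. Qed.

HB.instance Definition _ := Choice.on qtorus.
HB.instance Definition _ := GRing.isZmodule.Build qtorus qaddA qaddC qadd0 qaddN.

Lemma coefqD (f g : qtorus) k : (f + g : qtorus) k = f k + g k. Proof. exact: qaddE. Qed.
Lemma coefqN (f : qtorus) k : (- f : qtorus) k = - f k. Proof. exact: qoppE. Qed.
Lemma coefqB (f g : qtorus) k : (f - g : qtorus) k = f k - g k.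
Proof. by rewrite coefqD coefqN. Qed.
Lemma coefq0 k : (0 : qtorus) k = 0. Proof. exact: qzeroE. Qed.
Lemma coefq_sum (I : Type) (s : seq I) (P : pred I) (F : I -> qtorus) k :
  (\sum_(i <- s | P i) F i) k = \sum_(i <- s | P i) F i k.
Proof. by apply: (big_morph (fun f : qtorus => f k)) => [f g|]; rewrite (coefqD, coefq0). Qed.

Lemma qmono0 k : qmono 0 k = 0 :> qtorus.
Proof. by apply/fsfunP => l; rewrite qmonoE coefq0; case: ifP. Qed.

Lemma qmonoD c d k : qmono (c + d) k = qmono c k + qmono d k :> qtorus.
Proof. by apply/fsfunP => l; rewrite coefqD !qmonoE; case: ifP; rewrite ?addr0. Qed.

Lemma qtorusE (f : qtorus) : f = \sum_(k <- finsupp f) qmono (f k) k.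
Proof.
apply/fsfunP => l; rewrite coefq_sum.
have [lf|] := boolP (l \in finsupp f); last first.
  move=> lf; have := lf; rewrite memNfinsupp => /eqP ->; rewrite big_seq big1 // => k kf.
  by rewrite qmonoE; case: eqP => // lk; rewrite -lk (negPf lf) in kf.
rewrite (bigD1_seq l) ?fset_uniq //= qmonoE eqxx big1 ?addr0 // => k.
by rewrite eq_sym qmonoE => /negPf->.
Qed.

Lemma qtorus_ind (P : qtorus -> Prop) : P 0 -> (forall c k, P (qmono c k)) ->
  (forall f g, P f -> P g -> P (f + g)) -> forall f, P f.
Proof. by move=> P0 Pm PD f; rewrite (qtorusE f); apply: (big_ind P). Qed.

(** Larger index sets only add zero monomials; a common index set makes distributivity termwise. *)
Lemma qmul_wide (f g : qtorus) (A B : {fset key}) :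
  (finsupp f `<=` A)%fset -> (finsupp g `<=` B)%fset ->
  qmul f g = \sum_(k <- A) \sum_(l <- B) qmono (f k * g l) (kmul k l).
Proof.
move=> fA gB; rewrite [LHS](_ : _ =
  \sum_(k <- finsupp f) \sum_(l <- finsupp g) qmono (f k * g l) (kmul k l)) //.
rewrite -[RHS](big_fset_incl _ fA) => [|k _]; last first.
  by rewrite memNfinsupp => /eqP->; rewrite big1 // => l _; rewrite mul0r qmono0.
apply: eq_bigr => k _; apply: big_fset_incl => // l _.
by rewrite memNfinsupp => /eqP->; rewrite mulr0 qmono0.
Qed.

Fact qmulDl : left_distributive qmul (+%R : qtorus -> qtorus -> qtorus).
Proof.
move=> f g h; pose A := (finsupp f `|` finsupp g `|` finsupp (f + g)%R)%fset.
have fA : (finsupp f `<=` A)%fset by rewrite /A -fsetUA fsubsetUl.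
have gA : (finsupp g `<=` A)%fset by rewrite /A fsetUAC fsubsetUr.
have fgA : (finsupp (f + g)%R `<=` A)%fset by rewrite fsubsetUr.
have hh := fsubset_refl (finsupp h).
rewrite (qmul_wide fgA hh) (qmul_wide fA hh) (qmul_wide gA hh) -big_split.
apply: eq_bigr => k _; rewrite -big_split; apply: eq_bigr => l _.
by rewrite coefqD mulrDl qmonoD.
Qed.

Fact qmulDr : right_distributive qmul (+%R : qtorus -> qtorus -> qtorus).
Proof.
move=> h f g; pose A := (finsupp f `|` finsupp g `|` finsupp (f + g)%R)%fset.
have fA : (finsupp f `<=` A)%fset by rewrite /A -fsetUA fsubsetUl.
have gA : (finsupp g `<=` A)%fset by rewrite /A fsetUAC fsubsetUr.
have fgA : (finsupp (f + g)%R `<=` A)%fset by rewrite fsubsetUr.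
have hh := fsubset_refl (finsupp h).
rewrite (qmul_wide hh fgA) (qmul_wide hh fA) (qmul_wide hh gA) -big_split.
apply: eq_bigr => k _; rewrite -big_split; apply: eq_bigr => l _.
by rewrite coefqD mulrDr qmonoD.
Qed.

Lemma finsupp_qmono c k : (finsupp (qmono c k) `<=` [fset k])%fset.
Proof. exact: finsupp_sub. Qed.

Lemma qmul_qmono c k d l : qmul (qmono c k) (qmono d l) = qmono (c * d) (kmul k l).
Proof.
rewrite (qmul_wide (finsupp_qmono c k) (finsupp_qmono d l)) !big_seq_fset1.
by rewrite !qmonoE !eqxx.
Qed.

Lemma qmul0 (f : qtorus) : qmul f 0 = 0.
Proof. by apply: (addrI (qmul f 0)); rewrite -qmulDr !addr0. Qed.
Lemma q0mul (f : qtorus) : qmul 0 f = 0.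
Proof. by apply: (addrI (qmul 0 f)); rewrite -qmulDl !addr0. Qed.

Lemma kmulA : associative kmul.
Proof. by move=> [[r a] b] [[r' a'] b'] [[r'' a''] b'']; congr (_, _, _); ring. Qed.

Fact qmulA : associative qmul.
Proof.
move=> f g h.
elim/qtorus_ind: f => [|c k|f f' IH IH']; first by rewrite !q0mul.
  elim/qtorus_ind: g => [|c' k'|g g' IH IH']; first by rewrite !(q0mul, qmul0).
    elim/qtorus_ind: h => [|c'' k''|h h' IH IH']; first by rewrite !qmul0.
      by rewrite !qmul_qmono mulrA kmulA.
    by rewrite !qmulDr IH IH'.
  by rewrite qmulDl !qmulDr IH IH' qmulDl.
by rewrite !qmulDl IH IH'.
Qed.

Fact q1mul : left_id qone qmul.
Proof.
elim/qtorus_ind => [|c [[r a] b]|f g IH IH']; first exact: qmul0.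
  by rewrite qmul_qmono mul1r; congr (qmono _ (_, _, _)); ring.
by rewrite qmulDr IH IH'.
Qed.

Fact qmul1 : right_id qone qmul.
Proof.
elim/qtorus_ind => [|c [[r a] b]|f g IH IH']; first exact: q0mul.
  by rewrite qmul_qmono mulr1; congr (qmono _ (_, _, _)); ring.
by rewrite qmulDl IH IH'.
Qed.

HB.instance Definition _ :=
  GRing.Zmodule_isPzRing.Build qtorus qmulA q1mul qmul1 qmulDl qmulDr.

Lemma qmonoM c k d l : qmono c k * qmono d l = qmono (c * d) (kmul k l) :> qtorus.
Proof. exact: qmul_qmono. Qed.

Lemma qpowE (f : qtorus) n : qpow f n = f ^+ n.
Proof. by elim: n => // n IH; rewrite exprS -IH. Qed.

Lemma coefqM (f g : qtorus) m : (f * g : qtorus) m =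
  \sum_(k <- finsupp f) \sum_(l <- finsupp g) if m == kmul k l then f k * g l else 0.
Proof.
rewrite [f * g](_ : _ =
  \sum_(k <- finsupp f) \sum_(l <- finsupp g) qmono (f k * g l) (kmul k l)) //.
rewrite coefq_sum; apply: eq_bigr => k _; rewrite coefq_sum; apply: eq_bigr => l _.
exact: qmonoE.
Qed.

Lemma coefqM0 (f g : qtorus) m :
  (forall k l, f k != 0 -> g l != 0 -> m != kmul k l) -> (f * g : qtorus) m = 0.
Proof.
move=> H; rewrite coefqM big_seq big1 // => k kf; rewrite big_seq big1 // => l lg.
by rewrite mem_finsupp in kf; rewrite mem_finsupp in lg; rewrite (negPf (H k l kf lg)).
Qed.

(** Once the monomials at [k] and [l] are split off, no remaining pair of supported keys contributes
    to [kmul k l]. *)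
Lemma coefqM_lead (f g : qtorus) k l :
  (forall k' l', f k' != 0 -> g l' != 0 -> kmul k l = kmul k' l' -> k' = k /\ l' = l) ->
  (f * g : qtorus) (kmul k l) = f k * g l.
Proof.
move=> H; pose f' := f - qmono (f k) k; pose g' := g - qmono (g l) l.
have f'E k' : f' k' != 0 -> f k' != 0 /\ k' <> k.
  by rewrite coefqB qmonoE; case: (k' =P k) => [->|]; rewrite ?subrr ?eqxx // subr0.
have g'E l' : g' l' != 0 -> g l' != 0 /\ l' <> l.
  by rewrite coefqB qmonoE; case: (l' =P l) => [->|]; rewrite ?subrr ?eqxx // subr0.
have -> : f * g = f' * g + (qmono (f k) k * g' + qmono (f k) k * qmono (g l) l).
  by rewrite -mulrDr subrK -mulrDl subrK.
rewrite !coefqD qmonoM qmonoE eqxx coefqM0 ?add0r => [|k' l' fk' gl']; last first.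
  apply/eqP => e; have [fk nk] := f'E _ fk'.
  by have [] := H _ _ fk gl' e.
have [fk0|fk0] := eqVneq (f k) 0; first by rewrite fk0 qmono0 !mul0r coefq0 add0r.
rewrite coefqM0 ?add0r // => k' l' fk' gl'; apply/eqP => e.
have [gl nl] := g'E _ gl'; move: fk'; rewrite qmonoE; case: (k' =P k) => // kk _.
by have [] := H k l' fk0 gl; rewrite // e kk.
Qed.

(** The power of [v] is compared last because [kmul] twists only that component, by an amount fixed
    by the other exponents. *)
Definition kle (k l : key) : bool :=
  let: (r, a, b) := k in let: (r', a', b') := l in
  (a < a') || (a == a') && ((b < b') || (b == b') && (r <= r')).

Lemma kle_total : total kle.
Proof. by move=> [[r a] b] [[r' a'] b'] /=; lia. Qed.
Lemma kle_trans : transitive kle.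
Proof. by move=> [[r a] b] [[r' a'] b'] [[r'' a''] b''] /=; lia. Qed.

Lemma kmul_kle_inj k l k' l' : kle k k' -> kle l l' -> kmul k l = kmul k' l' ->
  k' = k /\ l' = l.
Proof.
case: k l k' l' => [[r a] b] [[s c] d] [[r' a'] b'] [[s' c'] d'] /= le1 le2 [e1 e2 e3].
have ea : a' = a by lia.
have ec : c' = c by lia.
have eb : b' = b by lia.
have ed : d' = d by lia.
subst a' c' b' d'; have er : r' = r by lia.
by have -> : s' = s by [lia]; rewrite er.
Qed.

Lemma seq_minimum (T : eqType) (le : rel T) (s : seq T) :
  total le -> transitive le -> s != [::] -> exists2 x, x \in s & {in s, forall y, le x y}.
Proof.
move=> tot tr; elim: s => // x s IH _.
have refl y : le y y by have := tot y y; rewrite orbb.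
have [->|/IH[y ys ymin]] := eqVneq s [::].
  by exists x; rewrite ?mem_head // => y; rewrite mem_seq1 => /eqP->.
have [xy|yx] := orP (tot x y).
  exists x; rewrite ?mem_head // => z; rewrite inE => /predU1P[->|/ymin]; first exact: refl.
  exact: tr.
by exists y; rewrite ?inE ?ys ?orbT // => z; rewrite inE => /predU1P[->|/ymin].
Qed.

Lemma qtorus_lead (f : qtorus) : f != 0 ->
  exists2 k, f k != 0 & forall l, f l != 0 -> kle k l.
Proof.
move=> f0; have [|k kf kmin] := @seq_minimum _ kle (finsupp f) kle_total kle_trans.
  apply: contra_neq f0 => f0; rewrite (qtorusE f).
  by rewrite f0 big_nil.
exists k; first by rewrite -mem_finsupp.
by move=> l lf; apply: kmin; rewrite mem_finsupp.
Qed.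

(** The product of the two lowest keys arises from a single pair, so its coefficient is a product of
    nonzero integers. *)
Lemma qtorus_domain (f g : qtorus) : f * g = 0 -> f != 0 -> g = 0.
Proof.
move=> fg0 f0; apply/eqP; apply: contraTT isT => g0.
have [k fk kmin] := qtorus_lead f0; have [l gl lmin] := qtorus_lead g0.
suff : (f * g : qtorus) (kmul k l) = f k * g l.
  by rewrite fg0 coefq0 => /esym/eqP; rewrite mulf_eq0 (negPf fk) (negPf gl).
apply: coefqM_lead => k' l' fk' gl'.
by apply: kmul_kle_inj; [apply: kmin | apply: lmin].
Qed.

Lemma qtorus_regl (f g h : qtorus) : f != 0 -> f * g = f * h -> g = h.
Proof.
move=> f0 e; apply/eqP; rewrite -subr_eq0; apply/eqP.
by apply: (@qtorus_domain f) => //; rewrite mulrBr e subrr.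
Qed.

Lemma qtorus_regr (f g h : qtorus) : f != 0 -> g * f = h * f -> g = h.
Proof.
move=> f0 e; apply/eqP; rewrite -subr_eq0; apply: contraNT f0 => gh.
by apply/eqP/(@qtorus_domain (g - h)) => //; rewrite mulrBl e subrr.
Qed.

(** * The bar-involution as an anti-automorphism *)

Definition kbar (k : key) : key := (- k.1.1, k.1.2, k.2).

Lemma kbarK : involutive kbar.
Proof. by move=> [[r a] b]; rewrite /kbar /= opprK. Qed.

Lemma coefq_bar (f : qtorus) k : qbar f k = f (kbar k).
Proof.
rewrite [qbar f](_ : _ = \sum_(l <- finsupp f) qmono (f l) (kbar l)) // coefq_sum.
rewrite [in RHS](qtorusE f) coefq_sum; apply: eq_bigr => l _; rewrite !qmonoE.
by rewrite -(inj_eq (can_inj kbarK) k) kbarK.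
Qed.

Lemma qbarD (f g : qtorus) : qbar (f + g) = qbar f + qbar g.
Proof. by apply/fsfunP => k; rewrite coefqD !coefq_bar coefqD. Qed.

Lemma qbarN (f : qtorus) : qbar (- f) = - qbar f.
Proof. by apply/fsfunP => k; rewrite coefqN !coefq_bar coefqN. Qed.

Lemma qbar0 : qbar 0 = 0.
Proof. by apply/fsfunP => k; rewrite coefq_bar !coefq0. Qed.

Lemma qbar_mono c k : qbar (qmono c k) = qmono c (kbar k).
Proof.
by apply/fsfunP => l; rewrite coefq_bar !qmonoE -(inj_eq (can_inj kbarK) l) kbarK.
Qed.

Lemma qbarM (f g : qtorus) : qbar (f * g) = qbar g * qbar f.
Proof.
elim/qtorus_ind: f => [|c k|f f' IH IH']; first by rewrite mul0r qbar0 mulr0.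
  elim/qtorus_ind: g => [|d l|g g' IH IH']; first by rewrite mulr0 qbar0 mul0r.
    rewrite qmonoM !qbar_mono qmonoM mulrC.
    by case: k l => [[r a] b] [[r' a'] b']; congr (qmono _ (_, _, _)) => /=; ring.
  by rewrite mulrDr !qbarD IH IH' mulrDl.
by rewrite mulrDl !qbarD IH IH' mulrDr.
Qed.

Lemma qbar1 : qbar 1 = 1.
Proof. exact: qbar_mono. Qed.

Lemma qbarX (f : qtorus) n : qbar (f ^+ n) = qbar f ^+ n.
Proof. by elim: n => [|n IH]; rewrite ?qbar1 // exprS qbarM IH exprSr. Qed.

(** * Scaling by central powers of [v] *)

Definition qsc (r : int) (f : qtorus) : qtorus := vq r * f.

Lemma vqD r s : vq (r + s) = vq r * vq s :> qtorus.
Proof. by rewrite qmonoM; congr (qmono _ (_, _, _)); ring. Qed.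

Lemma vqC r (f : qtorus) : f * vq r = vq r * f.
Proof.
elim/qtorus_ind: f => [|c [[s a] b]|f g IH IH']; first by rewrite mul0r mulr0.
  by rewrite !qmonoM mulrC; congr (qmono _ (_, _, _)); ring.
by rewrite mulrDl IH IH' mulrDr.
Qed.

Lemma qscP : scaling qsc.
Proof.
split=> [r f g|f|r s f|r f g|r f g]; rewrite /qsc.
- exact: mulrDr.
- exact: mul1r.
- by rewrite mulrA vqD.
- by rewrite mulrA.
- by rewrite !mulrA vqC.
Qed.

Lemma coefq_sc r (f : qtorus) s a b : qsc r f (s, a, b) = f (s - r, a, b).
Proof.
have -> : (s, a, b) = kmul (r, 0, 0) (s - r, a, b) by congr (_, _, _); ring.
rewrite coefqM_lead ?qmonoE ?eqxx ?mul1r // => k [[s' a'] b'].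
rewrite qmonoE; case: (k =P _) => // -> _ _ [e1 e2 e3]; split=> //.
by congr (_, _, _); lia.
Qed.

Lemma qbar_sc r (f : qtorus) : qbar (qsc r f) = qsc (- r) (qbar f).
Proof. by rewrite /qsc qbarM qbar_mono vqC. Qed.

(** * The cluster variables in the quantum torus *)

(** Both conclusions are checked after left multiplication by [x], where [x * z] is a polynomial in
    [y] and so commutes with [y]. *)
Lemma mutation_step (R : pzRingType) (sc : int -> R -> R) (scP : scaling sc) (x y z : R) (p : nat) :
  (forall f g, x * f = x * g -> f = g) -> x * y = sc 2 (y * x) ->
  x * z = sc p%:Z (y ^+ p) + 1 ->
  y * z = sc 2 (z * y) /\ z * x = sc (- p%:Z) (y ^+ p) + 1.
Proof.
move=> x_reg xy xz; split; apply: x_reg; rewrite mulrA.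
  rewrite xy (scMl scP) -mulrA xz (scMr scP) mulrA xz mulrDr mulrDl mulr1 mul1r.
  by rewrite (scMl scP) (scMr scP) -exprS -exprSr.
rewrite xz mulrDl mulrDr mul1r mulr1 (scMl scP) (scMr scP).
rewrite (qcomm_expl scP p (qcomm_sym scP xy)) (scA scP); congr (sc _ _ + _); lia.
Qed.

Lemma vq_eq1 r : vq r = 1 -> r = 0.
Proof.
move/(congr1 (fun f : qtorus => f (r, 0, 0))); rewrite qmonoE eqxx.
rewrite [RHS](_ : _ = qmono 1 (0, 0, 0) (r, 0, 0)) // qmonoE; case: eqP => // -[->] //.
Qed.

Section ClusterSeq.
Variables (X : int -> qtorus) (XP : cluster_seq X).

Lemma seq_mut k : X (k - 1) * X (k + 1) = qsc (mexp k)%:Z (X k ^+ mexp k) + 1.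
Proof.
case: XP => _ _ /(_ k); rewrite /mexp; case: (oddz k) => H; first by rewrite expr1; exact: H.
by rewrite -qpowE; exact: H.
Qed.

(** If a factor vanished, [v^p y^p] and [v^-p y^p] would both equal [-1], forcing [v^(2p) = 1]. *)
Lemma mutation_neq0 (x y z : qtorus) (p : nat) : (0 < p)%N ->
  x * z = qsc p%:Z (y ^+ p) + 1 -> z * x = qsc (- p%:Z) (y ^+ p) + 1 ->
  (x != 0) && (z != 0).
Proof.
move=> p0 xz zx; rewrite -negb_or; apply/negP => xz0.
have [] : x * z = 0 /\ z * x = 0 by case/orP: xz0 => /eqP->; rewrite mulr0 mul0r.
rewrite xz zx => /eqP; rewrite addr_eq0 => /eqP e1 /eqP; rewrite addr_eq0 => /eqP e2.
have : qsc (2 * p%:Z) (qsc (- p%:Z) (y ^+ p)) = qsc p%:Z (y ^+ p).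
  by rewrite (scA qscP); congr qsc; lia.
rewrite e1 e2 (scN qscP) => /oppr_inj; rewrite /qsc mulr1 => /vq_eq1; lia.
Qed.

(** The invariant of a seed that mutation propagates from the initial seed in both directions. *)
Definition good k := [/\ X k != 0, X (k + 1) != 0,
  X k * X (k + 1) = qsc 2 (X (k + 1) * X k), qbar (X k) = X k & qbar (X (k + 1)) = X (k + 1)].

Lemma good_up k : good k -> good (k + 1) /\
  X (k + 1 + 1) * X (k + 1 - 1) = qsc (- (mexp (k + 1))%:Z) (X (k + 1) ^+ mexp (k + 1)) + 1.
Proof.
move=> [x0 y0 xy bx by_]; have := seq_mut (k + 1); rewrite addrK => xz.
have [yz zx] := mutation_step qscP (fun f g => @qtorus_regl _ f g x0) xy xz.
split=> //; split=> //; first by have /andP[] := mutation_neq0 (mexp_gt0 _) xz zx.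
(* Bar reverses the exchange relation, so the new variable and its bar have the same product with
   [X k]. *)
apply: (@qtorus_regr (X k)) => //.
have := congr1 qbar xz; rewrite qbarM bx => ->.
rewrite qbarD qbar_sc.
rewrite qbarX by_ qbar1.
exact: esym zx.
Qed.

(** The mutation step is used in the converse ring, where the roles of the outer variables are
    exchanged. *)
Lemma good_down k : good k -> good (k - 1).
Proof.
move=> [y0 x0 yx by_ bx]; have zx := seq_mut k.
have [] := mutation_step (R := qtorus^c) (converse_scaling qscP) (x := X (k + 1)) (y := X k)
  (z := X (k - 1)) (p := mexp k).
- by move=> f g; apply: qtorus_regr.
- exact: yx.
- by rewrite converse_exp; exact: zx.
rewrite converse_exp => zy xz.
have /andP[z0 _] := mutation_neq0 (mexp_gt0 k) zx xz.
rewrite /good subrK; split=> //.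
apply: (@qtorus_regl (X (k + 1))) => //.
have := congr1 qbar zx; rewrite qbarM bx => ->; rewrite qbarD qbar_sc qbarX by_ qbar1.
by symmetry; exact: xz.
Qed.

Lemma good_all k : good k.
Proof.
have g1 : good 1.
  have [X1 X2 _] := XP; rewrite /good X1 [X (1 + 1)](_ : _ = tX 0 1) //.
  have nz c : qmono 1 c != 0 :> qtorus.
    apply/eqP => /(congr1 (fun f : qtorus => f c)).
    by rewrite qmonoE eqxx coefq0.
  split; rewrite ?nz ?qbar_mono //.
  by rewrite /qsc !qmonoM.
have [n] : exists n : nat, (`|k - 1| = n)%N by exists `|k - 1|%N.
elim: n k => [|n IH] k kn; first by have -> : k = 1 by lia.
have [k1|k1] := leP 1 k.
  have gk : good (k - 1) by apply: IH; lia.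
  by have [+ _] := good_up gk; rewrite subrK.
have gk : good (k + 1) by apply: IH; lia.
by have := good_down gk; rewrite addrK.
Qed.

Lemma cluster_of_seq : cluster qsc X.
Proof.
split=> k.
- by case: (good_all k).
- exact: seq_mut.
- have [_] := good_up (good_all (k - 1)); by rewrite subrK.
- by move=> f g; apply: qtorus_regr; case: (good_all k).
- by move=> f g; apply: qtorus_regl; case: (good_all k).
Qed.

Lemma qbarX_ k : qbar (X k) = X k. Proof. by case: (good_all k). Qed.

Lemma tXX n : tX 0 1 ^+ n = tX 0 n%:Z :> qtorus.
Proof.
elim: n => [|n IH] //; rewrite exprS IH qmonoM mulr1; congr (qmono _ (_, _, _)); lia.
Qed.

Lemma X3E : X 3 = tX (-1) 0 + tX (-1) 4.
Proof.
have [X1 X2 _] := XP; apply: (@qtorus_regl (X 1)); first by case: (good_all 1).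
have := seq_mut 2; rewrite [X (2 - 1)](_ : _ = X 1) // [X (2 + 1)](_ : _ = X 3) // => ->.
rewrite X1 X2 /qsc [mexp 2](_ : _ = 4%N) // tXX mulrDr !qmonoM mulr1 addrC.
by congr (_ + _).
Qed.

Lemma X0E : X 0 = tX 0 (-1) + tX 1 (-1).
Proof.
have [X1 X2 _] := XP; apply: (@qtorus_regr (X 2)); first by case: (good_all 2).
have := seq_mut 1; rewrite [X (1 - 1)](_ : _ = X 0) // [X (1 + 1)](_ : _ = X 2) // => ->.
rewrite X1 X2 /qsc [mexp 1](_ : _ = 1%N) // expr1 mulrDl !qmonoM mulr1 addrC.
by congr (_ + _).
Qed.

Lemma X4E : X 4 = tX 0 (-1) + tX (-1) (-1) + tX (-1) 3.
Proof.
have [X1 X2 _] := XP; apply: (@qtorus_regl (X 2)); first by case: (good_all 2).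
have := seq_mut 3; rewrite [X (3 - 1)](_ : _ = X 2) // [X (3 + 1)](_ : _ = X 4) // => ->.
rewrite X3E X2 /qsc [mexp 3](_ : _ = 1%N) // expr1 !mulrDr !qmonoM mulr1.
by abel.
Qed.

Lemma XdeltaE : Xdelta = tX (-1) (-2) + (tX (-1) 2 + (tX 1 (-2) +
   (qmono 1 (-1, 0, -2) + qmono 1 (1, 0, -2)))) :> qtorus.
Proof.
rewrite [LHS](_ : _ = tX (-1) (-2) + (tX (-1) 2 + (tX 1 (-2) +
  (vq (-1) + vq 1) * tX 0 (-2)))) //.
by rewrite mulrDl !qmonoM.
Qed.

Lemma Xdelta_delta2 : Xdelta = delta2 qsc X.
Proof.
have [X1 X2 _] := XP; rewrite XdeltaE /delta2 /delta /delta_of.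
rewrite [X (2 + 2)](_ : _ = X 4) // [X (2 - 2)](_ : _ = X 0) // X4E X0E X2 tXX /qsc.
rewrite !mulrDl !mulrDr !qmonoM.
by abel.
Qed.

Lemma cheb_chebr n : cheb Xdelta n = chebr (delta2 qsc X) n.
Proof.
rewrite Xdelta_delta2; suff: cheb (delta2 qsc X) n = chebr (delta2 qsc X) n /\
  cheb (delta2 qsc X) n.+1 = chebr (delta2 qsc X) n.+1 by case.
by elim: n => [|n [IH1 IH2]] //; split=> //; rewrite chebrSS -IH1 -IH2.
Qed.

Lemma qbar_delta2 : qbar (delta2 qsc X) = delta2 qsc X.
Proof. by rewrite -Xdelta_delta2 XdeltaE !qbarD !qbar_mono /kbar /= !oppr0 opprK; abel. Qed.

Lemma qbar_cheb n : qbar (chebr (delta2 qsc X) n) = chebr (delta2 qsc X) n.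
Proof.
suff: qbar (chebr (delta2 qsc X) n) = chebr (delta2 qsc X) n /\
  qbar (chebr (delta2 qsc X) n.+1) = chebr (delta2 qsc X) n.+1 by case.
elim: n => [|n [IH1 IH2]]; first by split; [exact: qbar1 | exact: qbar_delta2].
by split=> //; rewrite chebrSS qbarD qbarN qbarM IH1 IH2 qbar_delta2 chebr_comm.
Qed.

Lemma qbar_clmon k c d : qbar (clmon qsc X k c d) = clmon qsc X k c d.
Proof.
rewrite /clmon qbar_sc qbarM !qbarX !qbarX_.
rewrite (qcomm_exp qscP d c (qcomm_sym qscP (cl_comm cluster_of_seq k))) (scA qscP).
by congr qsc; lia.
Qed.

Lemma inA_exp f n : inA X f -> inA X (f ^+ n).
Proof.
move=> Af; elim: n => [|n IH]; first exact: (inA_scal X 0).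
by rewrite exprS; apply: inA_mul.
Qed.

Lemma inA_sc r f : inA X f -> inA X (qsc r f).
Proof. by move=> Af; apply: inA_mul => //; apply: inA_scal. Qed.

Lemma inA_clmon k c d : inA X (clmon qsc X k c d).
Proof. by apply: inA_sc; apply: inA_mul; apply: inA_exp; apply: inA_gen. Qed.

Lemma inA_delta2 : inA X (delta2 qsc X).
Proof.
apply: inA_add; first by apply: inA_sc; apply: inA_mul; apply: inA_gen.
by apply/inA_opp/inA_sc/inA_exp/inA_gen.
Qed.

Lemma inA_cheb n : inA X (chebr (delta2 qsc X) n).
Proof.
suff: inA X (chebr (delta2 qsc X) n) /\ inA X (chebr (delta2 qsc X) n.+1) by case.
elim: n => [|n [IH1 IH2]]; first by split; [exact: (inA_scal X 0) | exact: inA_delta2].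
split=> //; rewrite chebrSS; apply: inA_add; last exact: inA_opp.
by apply: inA_mul => //; exact: inA_delta2.
Qed.

Lemma seedE_stdE a b : seedE qsc X 1 a b = stdE X a b.
Proof.
have e0 : 1 - 1 = 0 :> int by [].
have e2 : 1 + 1 = 2 :> int by [].
have e3 : 1 + 2 = 3 :> int by [].
rewrite /seedE e0 e2 e3 /frameE /frameN /stdE !qpowE -!mulrA.
by rewrite /qsc; congr (vq _ * _); rewrite !pospE; congr (- (_ * _)); lia.
Qed.

(** * Lower bounds on the [X_1]-degree *)

Definition xge (n : int) (f : qtorus) := forall s x y, x < n -> f (s, x, y) = 0.

Lemma xge_le m n f : m <= n -> xge n f -> xge m f.
Proof. by move=> mn xf s x y xm; apply: xf; lia. Qed.

Lemma xgeD n (f g : qtorus) : xge n f -> xge n g -> xge n (f + g).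
Proof. by move=> xf xg s x y xn; rewrite coefqD xf // xg. Qed.

Lemma xgeN n (f : qtorus) : xge n f -> xge n (- f).
Proof. by move=> xf s x y xn; rewrite coefqN xf. Qed.

Lemma xge_sc n r f : xge n f -> xge n (qsc r f).
Proof. by move=> xf s x y xn; rewrite coefq_sc xf. Qed.

Lemma xgeM m n (f g : qtorus) : xge m f -> xge n g -> xge (m + n) (f * g).
Proof.
move=> xf xg s x y xmn; apply: coefqM0 => -[[r a] b] [[r' a'] b'] fk gl.
have am : m <= a by rewrite leNgt; apply: contra_neqN fk; apply: xf.
have an : n <= a' by rewrite leNgt; apply: contra_neqN gl; apply: xg.
by apply/eqP => -[_ e _]; lia.
Qed.

Lemma xge_mono n c r a b : n <= a -> xge n (qmono c (r, a, b)).
Proof. by move=> na s x y xn; rewrite qmonoE; case: eqP => // -[_ e _]; lia. Qed.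

(** In [X_(2n+4) = v (X_delta X_(2n+2) - v X_(2n))] the factor [X_delta] has degree at least [-1],
    so each step lowers the bound by one. *)
Lemma xge_X_even (n : nat) : xge (- n%:Z) (X (2 * n%:Z + 2)).
Proof.
have [X1 X2 _] := XP.
have xdel : xge (-1) (delta2 qsc X).
  by rewrite -Xdelta_delta2 XdeltaE; do ?apply: xgeD; apply: xge_mono.
suff: xge (- n%:Z) (X (2 * n%:Z)) /\ xge (- n%:Z) (X (2 * n%:Z + 2)) by case.
elim: n => [|n [IH1 IH2]].
  split; first by rewrite X0E; apply: xgeD; apply: xge_mono.
  by rewrite [X _](_ : _ = X 2) // X2; apply: xge_mono.
have -> : 2 * n.+1%:Z = 2 * n%:Z + 2 by lia.
split; first by apply: xge_le IH2; lia.
have -> : X (2 * n%:Z + 2 + 2) = qsc 1 (delta2 qsc X * X (2 * n%:Z + 2) - qsc 1 (X (2 * n%:Z))).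
  rewrite (delta2_even qscP cluster_of_seq) addrK (scA qscP) (sc_0 qscP); congr X; lia.
apply/xge_sc/xgeD; first by apply: xge_le (xgeM xdel IH2); lia.
by apply/xgeN/xge_sc; apply: xge_le IH1; lia.
Qed.

End ClusterSeq.

(** * Pointed elements and linear independence *)

Definition lexlt (x y a b : int) : bool := (x < a) || (x == a) && (y < b).

(** The lexicographically lowest term is [v^r X^(a,b)], with no other power of [v] at that
    exponent. *)
Definition pointed (f : qtorus) a b r :=
  (forall s x y, lexlt x y a b -> f (s, x, y) = 0) /\
  (forall s, f (s, a, b) = if s == r then 1 else 0).

Lemma pointed_mono r a b : pointed (qmono 1 (r, a, b)) a b r.
Proof.
split=> [s x y|s]; rewrite qmonoE; last by rewrite !xpair_eqE !eqxx !andbT.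
by case: eqP => // -[_ -> ->]; rewrite /lexlt; lia.
Qed.

Lemma pointedD (f g : qtorus) a b r : pointed f a b r ->
  (forall s x y, (lexlt x y a b || (x == a) && (y == b)) -> g (s, x, y) = 0) ->
  pointed (f + g) a b r.
Proof.
move=> [f1 f2] g0; split=> [s x y xy|s]; rewrite coefqD.
  by rewrite f1 // g0 ?addr0 // xy.
by rewrite f2 g0 ?addr0 // !eqxx orbT.
Qed.

Lemma pointedM (f g : qtorus) a b r a' b' r' : pointed f a b r -> pointed g a' b' r' ->
  pointed (f * g) (a + a') (b + b') (r + r' + (a * b' - b * a')).
Proof.
move=> [f1 f2] [g1 g2].
have f_lex s x y : f (s, x, y) != 0 -> ~~ lexlt x y a b.
  by apply: contra_neqN => /f1.
have g_lex s x y : g (s, x, y) != 0 -> ~~ lexlt x y a' b'.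
  by apply: contra_neqN => /g1.
have f_top s : f (s, a, b) != 0 -> s = r.
  by rewrite f2; case: (s =P r).
have g_top s : g (s, a', b') != 0 -> s = r'.
  by rewrite g2; case: (s =P r').
have split_eq x y x' y' : ~~ lexlt x y a b -> ~~ lexlt x' y' a' b' ->
    a + a' = x + x' -> b + b' = y + y' -> [/\ x = a, y = b, x' = a' & y' = b'].
  by rewrite /lexlt => *; split; lia.
split=> [s x y xy|s].
  apply: coefqM0 => -[[s1 x1] y1] [[s2 x2] y2] /f_lex f3 /g_lex g3.
  by apply/eqP => -[_ ex ey]; move: xy f3 g3; rewrite /lexlt; lia.
case: (s =P _) => [->|ns].
  have -> : (r + r' + (a * b' - b * a'), a + a', b + b') = kmul (r, a, b) (r', a', b') by [].
  rewrite coefqM_lead ?f2 ?g2 ?eqxx ?mulr1 // => -[[s1 x1] y1] [[s2 x2] y2] fk gl [_ e2 e3].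
  have [? ? ? ?] := split_eq _ _ _ _ (f_lex _ _ _ fk) (g_lex _ _ _ gl) e2 e3; subst.
  by rewrite (f_top _ fk) (g_top _ gl).
apply: coefqM0 => -[[s1 x1] y1] [[s2 x2] y2] fk gl; apply/eqP => -[e1 e2 e3].
have [? ? ? ?] := split_eq _ _ _ _ (f_lex _ _ _ fk) (g_lex _ _ _ gl) e2 e3; subst.
by apply: ns; rewrite (f_top _ fk) (g_top _ gl).
Qed.

Lemma pointedX (f : qtorus) a b n : pointed f a b 0 ->
  pointed (f ^+ n) (n%:Z * a) (n%:Z * b) 0.
Proof.
move=> pf; elim: n => [|n IH]; first by rewrite !mul0r; apply: pointed_mono.
rewrite exprS; move: (pointedM pf IH); congr (pointed _ _ _ _); rewrite ?intS; ring.
Qed.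

Lemma coefq_monoM c r (f : qtorus) s a b :
  (qmono c (r, 0, 0) * f : qtorus) (s, a, b) = c * f (s - r, a, b).
Proof.
have -> : (s, a, b) = kmul (r, 0, 0) (s - r, a, b) by congr (_, _, _); ring.
rewrite coefqM_lead ?qmonoE ?eqxx // => k [[s' a'] b'].
rewrite qmonoE; case: (k =P _) => // -> _ _ [e1 e2 e3]; split=> //.
by congr (_, _, _); lia.
Qed.

Section LinearIndependence.
Variable E : int * int -> qtorus.
Hypothesis E_pointed : forall k, pointed (E k) k.1 k.2 0.

Definition term_sum (s : seq (int * nat * (int * int))) : qtorus :=
  \sum_(t <- s) qmono t.1.1 (- (t.1.2 : int), 0, 0) * E t.2.

Definition lexle (k l : int * int) : bool := (k == l) || lexlt k.1 k.2 l.1 l.2.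

Lemma lexle_total : total lexle.
Proof. by move=> [a b] [a' b']; rewrite /lexle /lexlt !xpair_eqE /=; lia. Qed.

Lemma lexle_trans : transitive lexle.
Proof.
by move=> [a b] [a' b'] [a'' b'']; rewrite /lexle /lexlt !xpair_eqE /=; lia.
Qed.

(** After grouping by index, the least index with nonzero total coefficient keeps that coefficient,
    since the later pointed elements have no term there. *)
Lemma term_sum_lead s : term_sum s = 0 \/ exists a b, [/\ (a, b) \in map snd s,
  exists r, term_sum s (r, a, b) != 0 & forall r, 0 < r -> term_sum s (r, a, b) = 0].
Proof.
(* The total coefficient of [E k], an element of [Z[v^-1]]. *)
pose h k : qtorus := \sum_(t <- s | t.2 == k) qmono t.1.1 (- (t.1.2 : int), 0, 0).
have sE : term_sum s = \sum_(k <- undup (map snd s)) h k * E k.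
  transitivity (\sum_(t <- s) \sum_(k <- undup (map snd s) | t.2 == k)
      qmono t.1.1 (- (t.1.2 : int), 0, 0) * E k).
    rewrite /term_sum big_seq [RHS]big_seq; apply: eq_bigr => t ts.
    rewrite big_mkcond (bigD1_seq t.2) ?undup_uniq ?mem_undup ?map_f //= eqxx big1 ?addr0 //.
    by move=> k; rewrite eq_sym => /negPf->.
  rewrite (exchange_big_dep xpredT) //=; apply: eq_bigr => k _.
  by rewrite mulr_suml.
have hE k r x y : (h k * E k) (r, x, y) =
    \sum_(t <- s | t.2 == k) t.1.1 * E k (r + (t.1.2 : int), x, y).
  rewrite mulr_suml coefq_sum; apply: eq_bigr => t _.
  by rewrite coefq_monoM opprK.
have h_low k r x y : lexlt x y k.1 k.2 -> (h k * E k) (r, x, y) = 0.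
  by move=> xy; rewrite hE big1 // => t _; case: (E_pointed k) => ->; rewrite ?mulr0.
have h_top k r : (h k * E k) (r, k.1, k.2) = h k (r, 0, 0).
  rewrite hE coefq_sum; apply: eq_bigr => t _; case: (E_pointed k) => _ ->.
  by rewrite qmonoE !xpair_eqE !eqxx !andbT addr_eq0; case: ifP; rewrite ?mulr1 ?mulr0.
have h_pos k r : 0 < r -> h k (r, 0, 0) = 0.
  move=> r0; rewrite coefq_sum big1 // => t _; rewrite qmonoE.
  by case: eqP => // -[e]; lia.
have h_scal k r x y : h k (r, x, y) != 0 -> (x == 0) && (y == 0).
  apply: contraTT => nxy; rewrite negbK coefq_sum big1 // => t _; rewrite qmonoE.
  by case: eqP => // -[_ e1 e2]; rewrite e1 e2 in nxy.
rewrite sE; have : {subset undup (map snd s) <= map snd s} by move=> k; rewrite mem_undup.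
have := undup_uniq (map snd s); move: (undup _) => K.
have [n] := ubnP (size K); elim: n K => // n IH K szK uK subK.
have [->|K0] := eqVneq K [::]; first by left; rewrite big_nil.
have [k kK kmin] := seq_minimum lexle_total lexle_trans K0.
rewrite (big_rem k kK) /=.
have [h0|h0] := eqVneq (h k) 0.
  rewrite h0 mul0r add0r; apply: IH; first by move: K0; rewrite size_rem // -size_eq0; lia.
    exact: rem_uniq.
  by move=> l /mem_rem /subK.
right; exists k.1, k.2.
have coefE r : (h k * E k + \sum_(l <- rem k K) h l * E l : qtorus) (r, k.1, k.2) = h k (r, 0, 0).
  rewrite coefqD h_top -[RHS]addr0; congr (_ + _); rewrite coefq_sum big_seq big1 // => l.
  rewrite mem_rem_uniq // inE => /andP[lk lK]; apply: h_low.
  by have := kmin l lK; rewrite /lexle eq_sym (negPf lk).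
split.
- by rewrite -surjective_pairing; apply: subK.
- have [[[r x] y] hk _] := qtorus_lead h0; have /andP[/eqP ex /eqP ey] := h_scal _ _ _ _ hk.
  by rewrite ex ey in hk; exists r; rewrite coefE.
- by move=> r r0; rewrite coefE h_pos.
Qed.

End LinearIndependence.

(** * The triangular basis *)

Section Main.
Variables (X : int -> qtorus) (XP : cluster_seq X).

Let clP := cluster_of_seq XP.

Lemma stdE_pointed a b : pointed (stdE X a b) a b 0.
Proof.
have [X1 X2 _] := XP.
have p3 : pointed (X 3) (-1) 0 0.
  rewrite (X3E XP); apply: pointedD; first exact: pointed_mono.
  by move=> s x y xy; rewrite qmonoE; case: eqP => // -[_ ex ey]; move: xy; rewrite ex ey.
have p0 : pointed (X 0) 0 (-1) 0.
  rewrite (X0E XP); apply: pointedD; first exact: pointed_mono.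
  by move=> s x y xy; rewrite qmonoE; case: eqP => // -[_ ex ey]; move: xy; rewrite ex ey.
have p1 : pointed (X 1) 1 0 0 by rewrite X1; apply: pointed_mono.
have p2 : pointed (X 2) 0 1 0 by rewrite X2; apply: pointed_mono.
have := pointedM (pointed_mono (- (a * b)) 0 0) (pointedM (pointedX (posp (- a)) p3)
  (pointedM (pointedX (posp a) p1) (pointedM (pointedX (posp b) p2) (pointedX (posp (- b)) p0)))).
have ea : (posp a)%:Z - (posp (- a))%:Z = a by rewrite !pospE; lia.
have eb : (posp b)%:Z - (posp (- b))%:Z = b by rewrite !pospE; lia.
have eab : a * b = ((posp a)%:Z - (posp (- a))%:Z) * ((posp b)%:Z - (posp (- b))%:Z).
  by rewrite ea eb.
rewrite /stdE !qpowE eab; congr (pointed _ _ _ _); [rewrite -[RHS]ea | rewrite -[RHS]eb |]; ring.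
Qed.

Lemma inAplusE g : inAplus X g <-> exists s, g = term_sum (fun k => stdE X k.1 k.2) s.
Proof. by []. Qed.

Lemma inAplusB f g : inAplus X f -> inAplus X g -> inAplus X (f - g).
Proof.
rewrite !inAplusE => -[s ->] [t ->]; exists (s ++ [seq (- u.1.1, u.1.2, u.2) | u <- t]).
rewrite /term_sum big_cat big_map -sumrN; congr (_ + _); apply: eq_bigr => u _ /=.
rewrite -mulNr; congr (_ * _); apply/fsfunP => k.
by rewrite coefqN !qmonoE; case: ifP; rewrite ?oppr0.
Qed.

Lemma inAplus_Zspan g : Zspan qsc (seedG qsc X 1) g -> inAplus X g.
Proof.
have A0 : inAplus X 0 by apply/inAplusE; exists [::]; rewrite /term_sum big_nil.
have AN f : inAplus X f -> inAplus X (- f) by rewrite -sub0r; apply: inAplusB.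
elim=> [|j x [a [b ->]]|x y _ Ax _ Ay|x _ Ax] //.
- apply/inAplusE; exists [:: (1, j, (a, b))].
  by rewrite /term_sum big_seq1 -seedE_stdE.
- by rewrite -[y]opprK; apply: inAplusB => //; apply: AN.
- exact: AN.
Qed.

(* Leading coefficients of a bar-invariant element are palindromic in [v]. *)
Lemma bar_inv_Aplus g : inAplus X g -> qbar (qsc (-1) g) = qsc (-1) g -> g = 0.
Proof.
move=> /inAplusE[s ->] bg.
have [//|[a [b [_ [r nz] pos]]]] := term_sum_lead (fun k => stdE_pointed k.1 k.2) s.
have sym t : term_sum (fun k => stdE X k.1 k.2) s (t + 1, a, b)
    = term_sum (fun k => stdE X k.1 k.2) s (- t + 1, a, b).
  have := congr1 (fun f : qtorus => f (t, a, b)) bg.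
  by rewrite coefq_bar !coefq_sc opprK /= => ->.
case/eqP: nz; have [r0|r0] := leP r 0; last exact: pos.
by have := sym (r - 1); rewrite subrK => ->; apply: pos; lia.
Qed.

(** The terms of first index below [n] sum to an element of degree at least [n]; were it nonzero,
    its lowest term would sit at one of those indices. *)
Lemma truncate_Zspan n g : xge n g -> Zspan qsc (seedG qsc X 1) g ->
  Zspan qsc (fun x => exists a b, n <= a /\ x = seedE qsc X 1 a b) g.
Proof.
move=> xg /inAplus_Zspan/inAplusE[s sE].
pose E k := stdE X k.1 k.2.
pose s1 := [seq t <- s | n <= t.2.1]; pose s2 := [seq t <- s | ~~ (n <= t.2.1)].
have s12 : g = term_sum E s1 + term_sum E s2.
  rewrite sE /term_sum !big_filter; exact: bigID.
have span1 : Zspan qsc (fun x => exists a b, n <= a /\ x = seedE qsc X 1 a b) (term_sum E s1).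
  rewrite /term_sum big_filter; apply: (big_ind (Zspan qsc _)) => [||t nt].
  - exact: Zspan0.
  - exact: ZspanD.
  case: t nt => [[c j] [a b]] /= na.
  have spE : Zspan qsc (fun x => exists a b, n <= a /\ x = seedE qsc X 1 a b)
      (qmono 1 (- (j : int), 0, 0) * E (a, b)).
    by apply: Zspan_gen; exists a, b; rewrite seedE_stdE.
  (* [Zspan] has no integer multiples as constructors, so coefficients are unfolded into repeated
     sums and a sign. *)
  have mn (i : nat) : qmono i%:Z (- (j : int), 0, 0) * E (a, b)
      = (qmono 1 (- (j : int), 0, 0) * E (a, b)) *+ i.
    elim: i => [|i IH]; first by rewrite qmono0 mul0r.
    by rewrite intS qmonoD mulrDl IH mulrS.
  have sp (i : nat) : Zspan qsc (fun x => exists a b, n <= a /\ x = seedE qsc X 1 a b)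
      (qmono i%:Z (- (j : int), 0, 0) * E (a, b)).
    by rewrite mn; elim: i => [|i IH]; rewrite ?mulrS; [apply: Zspan0 | apply: ZspanD].
  have [c0|c0] := leP 0 c; first by have -> : c = `|c|%N by lia.
  have -> : qmono c (- (j : int), 0, 0) = - qmono `|c|%N%:Z (- (j : int), 0, 0) :> qtorus.
    by apply/fsfunP => k; rewrite coefqN !qmonoE; case: ifP; lia.
  by rewrite mulNr; apply: ZspanN.
have E_ge a b : n <= a -> xge n (E (a, b)).
  move=> na r x y xn; case: (stdE_pointed a b) => H _; apply: H.
  by rewrite /lexlt; lia.
have x1 : xge n (term_sum E s1).
  rewrite /term_sum big_filter; apply: (big_ind (xge n)) => [||[[c j] [a b]] /= na].
  - by move=> ? ? ? _; rewrite coefq0.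
  - exact: xgeD.
  by move=> r x y xn; rewrite coefq_monoM E_ge ?mulr0.
have x2 : xge n (term_sum E s2).
  have -> : term_sum E s2 = g - term_sum E s1 by rewrite s12; abel.
  by apply: xgeD => //; apply: xgeN.
have [s20|[a [b [ab [r nz] _]]]] := term_sum_lead (fun k => stdE_pointed k.1 k.2) s2.
  by rewrite s12 [term_sum E s2]s20 addr0.
case/eqP: nz; apply: x2; move: ab => /mapP[t]; rewrite mem_filter => /andP[nt _] e.
by rewrite -ltNge -e /= in nt.
Qed.

Lemma near_clprod_all (n : nat) :
  near qsc (seedG qsc X 1) (clprod qsc X n) (seedE qsc X 1 (- n%:Z) (- (2 * n%:Z))).
Proof.
have := near_X_even qscP clP n (m := 1) isT.
have -> : 1 + 2 * n%:Z + 1 = 2 * n%:Z + 2 by lia.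
move=> [g Gg gE].
apply: (near_clprod qscP clP _ gE); apply: truncate_Zspan => //.
have -> : g = qsc 1 (X (2 * n%:Z + 2) - seedE qsc X 1 (- n%:Z) (1 - 2 * n%:Z)).
  by rewrite gE addrC addKr (scA qscP) (sc_0 qscP).
apply/xge_sc/xgeD; first exact: xge_X_even.
apply: xgeN; rewrite seedE_stdE => s x y xn.
by case: (stdE_pointed (- n%:Z) (1 - 2 * n%:Z)) => H _; apply: H; rewrite /lexlt xn.
Qed.

Lemma tri_of_near a b s : inA X s -> qbar s = s ->
  near qsc (seedG qsc X 1) s (seedE qsc X 1 a b) -> is_tri_basis_elt X a b s.
Proof.
move=> As bs [g Gg sE]; split=> //; exists g; split; first exact: inAplus_Zspan.
have : s - stdE X a b = qsc (-1) g by rewrite sE seedE_stdE addrC addKr.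
by [].
Qed.

(** The difference is bar-invariant and lies in [v^-1 A_+], so [bar_inv_Aplus] kills it. *)
Lemma tri_unique a b s s' : is_tri_basis_elt X a b s -> is_tri_basis_elt X a b s' -> s = s'.
Proof.
move=> [_ bs [g [Ag gE]]] [_ bs' [g' [Ag' gE']]].
have e : s - s' = qsc (-1) (g - g').
  rewrite (scB qscP) -[qsc _ g]gE -[qsc _ g']gE'.
  have qsubE (x y : qtorus) : qsub x y = x - y by [].
  by rewrite !qsubE; abel.
have g0 : g - g' = 0.
  apply: bar_inv_Aplus; first exact: inAplusB.
  by rewrite -e qbarD qbarN bs bs'.
by apply/eqP; rewrite -subr_eq0 e g0 (sc0r qscP).
Qed.

Lemma inS_cases s : inS X s <->
  (exists k c d, s = clmon qsc X k c d) \/ (exists n, (1 <= n)%N /\ s = chebr (delta2 qsc X) n).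
Proof.
have monE k c d : clmon qsc X k c d =
    qmul (vq (- (c%:Z * d%:Z))) (qmul (qpow (X k) c) (qpow (X (k + 1)) d)).
  by rewrite !qpowE.
split=> [] [[k [c [d ->]]]|[n [n1 ->]]].
- by left; exists k, c, d; rewrite monE.
- by right; exists n; rewrite -(cheb_chebr XP).
- by left; exists k, c, d; rewrite monE.
- by right; exists n; rewrite (cheb_chebr XP).
Qed.

Lemma tri_clmon k c d a b : near_at qsc X 1 (clmon qsc X k c d) a b ->
  is_tri_basis_elt X a b (clmon qsc X k c d).
Proof. by apply: tri_of_near; [apply: inA_clmon | apply: qbar_clmon]. Qed.

Lemma tri_cheb (n : nat) :
  is_tri_basis_elt X (- n%:Z) (- (2 * n%:Z)) (chebr (delta2 qsc X) n).
Proof.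
apply: tri_of_near; [exact: inA_cheb | exact: qbar_cheb |].
exact: (near_cheb qscP clP near_clprod_all).
Qed.

(** Every index carries a member of the set, a cluster monomial or a Chebyshev element, so
    uniqueness gives the converse. *)
Lemma inS_tri s : inS X s <-> exists a b, is_tri_basis_elt X a b s.
Proof.
rewrite inS_cases; split=> [[[k [c [d ->]]]|[n [_ ->]]]|[a [b tri]]].
- have [a [b nab]] := near_clmon qscP clP k c d 1.
  by exists a, b; apply: tri_clmon.
- by exists (- n%:Z), (- (2 * n%:Z)); apply: tri_cheb.
have [ab|] := boolP ((0 <= a) || (b != 2 * a)).
  have [k [c [d nab]]] := reached_all qscP clP (m := 1) isT ab.
  by left; exists k, c, d; apply: tri_unique tri (tri_clmon nab).
rewrite negb_or negbK -ltNge => /andP[a0 /eqP b2].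
(* The exceptional indices have [a < 0], so the Chebyshev degree is at least 1. *)
right; exists `|a|%N; split; first by lia.
have e1 : - `|a|%N%:Z = a by lia.
have e2 : - (2 * `|a|%N%:Z) = b by lia.
by apply: tri_unique tri _; have := tri_cheb `|a|%N; rewrite e1 e2.
Qed.

End Main.

Theorem theorem4p12 (X : int -> qtorus) :
  cluster_seq X ->
  forall s : qtorus, inS X s <-> exists a b : int, is_tri_basis_elt X a b s.
Proof. by move=> XP s; apply: inS_tri. Qed.
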